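(* Let $G$ be a fixed graph without isolated vertices, consisting of $k\ge 2$ edges and $l\ge 3$ vertices, and let $a=\mathrm{aut}(G)$ be the order of its automorphism group. Let $p=p(n)\in(0,1)$, and let $(\beta_n)_n$ be an increasing sequence of positive reals with $$n^{l-1}p^{k-1}\sqrt{p(1-p)}\ \ll\ \beta_n\ \ll\ n^{l}\left(p^{k-1}\sqrt{p(1-p)}\right)^4 .$$ Then the sequence $(S_n)_n$ of subgraph count statistics $$S_n:=\frac{1}{\beta_n}\sum_{1\le \kappa_1<\dots<\kappa_k\le \binom n2} 1_{\{(e_{\kappa_1},\dots,e_{\kappa_k})\sim G\}}\left(\prod_{i=1}^k X_{\kappa_i}-p^k\right)$$ satisfies a moderate deviation principle with speed $$s_n=\frac{\left(\frac{2k}{a}(l-2)!\right)^2\beta_n^2}{c_{n,p}^2}=\frac{1}{\binom{n-2}{l-2}^2\binom n2}\,\frac{1}{p^{2k-1}(1-p)}\,\beta_n^2$$ and rate function $$I(x)=\frac{x^2}{2\left(\frac{2k}{a}(l-2)!\right)^2},\qquad x\in\mathbb R .$$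
   Context: Random graph: for each $n$, consider the Erdős–Rényi random graph on $n$ vertices. The $\binom n2$ pairs of vertices (edges of the complete graph $K_n$) are enumerated $e_1,\dots,e_{\binom n2}$, and $X_1,\dots,X_{\binom n2}$ are independent with $P(X_i=1)=1-P(X_i=0)=p=p(n)$, where $X_i=1$ means that edge $e_i$ is present. $(e_{\kappa_1},\dots,e_{\kappa_k})\sim G$ means that the subgraph of $K_n$ formed by the edges $e_{\kappa_1},\dots,e_{\kappa_k}$ is isomorphic to $G$. The normalization is $$c_{n,p}:=\binom{n-2}{l-2}\frac{2k}{a}(l-2)!\sqrt{\binom n2 p(1-p)}\;p^{k-1}.$$ $u_n\ll v_n$ means $u_n/v_n\to 0$ as $n\to\infty$. Large deviation principle (LDP): a sequence of real random variables $(S_n)$ with laws $\mu_n$ satisfies the LDP with speed $s_n\nearrow\infty$ and good rate function $I$ if the level sets $\{x: I(x)\le\alpha\}$ are compact for all $\alpha\in[0,\infty)$ and for all Borel sets $\Gamma$, $$-\inf_{x\in \mathrm{int}(\Gamma)}I(x)\le\liminf_{n\to\infty}\frac1{s_n}\log\mu_n(\Gamma)\le\limsup_{n\to\infty}\frac1{s_n}\log\mu_n(\Gamma)\le-\inf_{x\in \mathrm{cl}(\Gamma)}I(x).$$ A moderate deviation principle (MDP) is formally nothing else but an LDP; the name is used when the scaling lies between that of a law of large numbers and that of a central limit theorem. *)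

(* Defs.v *)
From HB Require Import structures.
From mathcomp Require Import all_boot all_order all_algebra all_fingroup.
From mathcomp Require Import all_classical all_reals all_analysis.
From mathcomp Require Import measurable_realfun.

Set Implicit Arguments.
Unset Strict Implicit.
Unset Printing Implicit Defensive.

Import Order.TTheory GRing.Theory Num.Theory.
Import numFieldNormedType.Exports.

Local Open Scope classical_set_scope.
Local Open Scope ring_scope.

Record simple_graph := SimpleGraph {
  vertex :> finType;
  adj : rel vertex;
  adj_sym : symmetric adj;
  adj_irr : irreflexive adj }.

Definition edges (G : simple_graph) : {set {set G}} :=
  [set [set u.1; u.2] | u in [pred u : G * G | adj u.1 u.2]]%SET.

Definition no_isolated_vertex (G : simple_graph) : Prop :=
  forall x : G, exists y : G, adj x y.

Definition aut_order (G : simple_graph) : nat :=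
  #|[set s : {perm G} | [forall x, forall y, adj (s x) (s y) == adj x y]]%SET|.

Definition graph_iso (G H : simple_graph) : Prop :=
  exists f : G -> H, bijective f /\ forall x y, adj (f x) (f y) = adj x y.

Section EdgeSubgraph.
Variables (W : finType) (F : {set {set W}}).

(* The graph formed by the edges in F: its vertices are the endpoints of
   these edges, so it has no isolated vertices. *)
Definition edge_subgraph_vertex := {v : W | v \in finset.cover F}.

Definition edge_subgraph_adj : rel edge_subgraph_vertex :=
  fun u v => (u != v) && ([set val u; val v]%SET \in F).

Lemma edge_subgraph_adj_sym : symmetric edge_subgraph_adj.
Proof. by move=> u v; rewrite /edge_subgraph_adj eq_sym finset.setUC. Qed.

Lemma edge_subgraph_adj_irr : irreflexive edge_subgraph_adj.
Proof. by move=> u; rewrite /edge_subgraph_adj eqxx. Qed.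

Definition edge_subgraph : simple_graph :=
  SimpleGraph edge_subgraph_adj_sym edge_subgraph_adj_irr.

End EdgeSubgraph.

Definition edge_enumeration (n : nat) (e : 'I_'C(n, 2) -> {set 'I_n}) : Prop :=
  injective e /\
  [set e i | i : 'I_'C(n, 2)]%SET = [set A : {set 'I_n} | #|A| == 2%N]%SET.

(* (e_{kappa_1}, ..., e_{kappa_k}) ~ G *)
Definition forms_copy (G : simple_graph) (n k : nat)
    (e : 'I_'C(n, 2) -> {set 'I_n}) (kappa : k.-tuple 'I_'C(n, 2)) : Prop :=
  graph_iso (edge_subgraph [set e i | i in kappa]%SET) G.

Section RandomVariables.
Context {d : measure_display} {T : measurableType d} {R : realType}
  {P : probability T R}.

Definition mutually_independent (I : finType) (X : I -> {RV P >-> R}) : Prop :=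
  forall (J : {set I}) (B : I -> set R), (forall i, measurable (B i)) ->
    P (\bigcap_(i in [set` J]) (X i @^-1` B i)) =
    (\prod_(i in J) P (X i @^-1` B i))%E.

Definition bernoulli_rv (p : R) (X : {RV P >-> R}) : Prop :=
  P (X @^-1` [set 1]) = p%:E /\ P (X @^-1` [set 0]) = (1 - p)%:E.

Section SubgraphCount.
Variables (G : simple_graph) (n k : nat) (e : 'I_'C(n, 2) -> {set 'I_n})
  (X : 'I_'C(n, 2) -> {RV P >-> R}) (p b : R).

Definition subgraph_count_stat (w : T) : R :=
  b^-1 * \sum_(kappa : k.-tuple 'I_'C(n, 2)
                 | sorted (fun i j : 'I_'C(n, 2) => (i < j)%N) kappa)
    (`[< forms_copy G e kappa >])%:R * (\prod_(i < k) X (tnth kappa i) w - p ^+ k).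

Lemma measurable_subgraph_count_stat : measurable_fun setT subgraph_count_stat.
Proof.
apply: measurable_funM => //.
under eq_fun do rewrite -big_filter.
apply: measurable_sum => kappa; apply: measurable_funM => //.
by apply: measurable_funB => //; apply: measurable_prod.
Qed.

HB.instance Definition _ := isMeasurableFun.Build d _ T R subgraph_count_stat
  measurable_subgraph_count_stat.

Definition subgraph_count_rv : {RV P >-> R} := subgraph_count_stat.

End SubgraphCount.
End RandomVariables.

Section LargeDeviations.
Context {R : realType}.

Definition negligible_wrt (u v : nat -> R) : Prop :=
  u n / v n @[n --> \oo] --> 0.

Definition good_rate_function (I : R -> \bar R) : Prop :=
  (forall x, (0 <= I x)%E) /\
  forall alpha : R, 0 <= alpha -> compact [set x | (I x <= alpha%:E)%E].

Local Open Scope ereal_scope.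

(* The speed is only required to diverge, not to be monotone.  The logarithm
   is extended by lne 0 = -oo. *)
Definition LDP (mu : nat -> probability R R) (s : nat -> R)
    (I : R -> \bar R) : Prop :=
  [/\ s n @[n --> \oo] --> +oo%R,
      good_rate_function I &
      forall Gamma : set R, measurable Gamma ->
        [/\ - ereal_inf [set I x | x in Gamma°] <=
              limn_einf (fun n => (s n)^-1%:E * lne (mu n Gamma)),
            limn_einf (fun n => (s n)^-1%:E * lne (mu n Gamma)) <=
              limn_esup (fun n => (s n)^-1%:E * lne (mu n Gamma)) &
            limn_esup (fun n => (s n)^-1%:E * lne (mu n Gamma)) <=
              - ereal_inf [set I x | x in closure Gamma]]].

End LargeDeviations.

Section Normalization.
Context {R : realType}.

Definition cnp (k l a n : nat) (p : R) : R :=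
  'C(n - 2, l - 2)%:R * (2 * k%:R / a%:R) * (l - 2)`!%:R *
  Num.sqrt ('C(n, 2)%:R * p * (1 - p)) * p ^+ (k - 1).

End Normalization.

(* Main.v *)
(** Summing over injections [f : G -> 'I_n] instead of copies, [a beta_n S_n] is
    the centred count [F] of a family of [k]-subsets [K f] of the edge set, in
    which every edge has the same degree [D] and two distinct edges have
    codegree [O(n^(l-3))].  Write [F = D p^(k-1) sum_i (X_i - p) + W].  The
    linear term has an explicit Laplace transform, which gives the Gaussian
    limit of the normalised cumulant generating function.  For the remainder
    [W], the exponential martingale obtained by integrating out one edge at a
    time, together with Cauchy-Schwarz, gives
    [E exp(t W) <= E exp(4 t^2 V)] with [V] the sum of the squared predictable
    jumps; a second application of the same inequality (bounded differences)
    to [V], whose mean is controlled by the Efron-Stein inequality and the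
    codegrees, yields
    [log E exp(t W) <= C (t^2 N D D2 + t^4 N D^4)].
    Both terms are negligible against the speed: the first because
    [n p^(2k-1) (1-p)] tends to infinity, the second because of the upper bound
    on [beta].  Hoelder's inequality transfers the limit from the linear term to
    [F], and a one-dimensional Gaertner-Ellis argument gives the MDP. *)

Require Import Defs.
From HB Require Import structures.
From mathcomp Require Import all_boot all_order all_algebra all_fingroup.
From mathcomp Require Import all_classical all_reals all_analysis.
From mathcomp Require Import ring lra zify.

Set Implicit Arguments.
Unset Strict Implicit.
Unset Printing Implicit Defensive.

Import Order.TTheory GRing.Theory Num.Theory.
Import numFieldNormedType.Exports.

Local Open Scope classical_set_scope.
Local Open Scope ring_scope.

(** * Exponential inequalities on the discrete cube *)

(** The obstacle is the size of the remainder. Bounded differences applied to [W] directly give an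
    exponent of order [t^2 N D^2]. At the scale of [t] that matters, of order [s_n / beta_n], this
    is of order [s_n / q^2] with [q = p^(k-1) sqrt(p (1-p))], never of smaller order than the speed.
    The worst-case jump [D] has to be replaced by its typical size: the squared jumps are kept as a
    random variable, its mean is governed by second differences, and only its fluctuation is treated
    by a worst-case bound. That fluctuation is the term with [t^4]; relative to the speed it is of
    order [beta_n^2 / (n^(2l) q^6)]. The two growth hypotheses multiplied together eliminate
    [beta_n] and give that [n q^3] tends to infinity, which is the source of the growth of
    [n q^2 = n p^(2k-1) (1-p)]. Injections are preferred to copies because vertex permutations act
    on them, so that the equality of all degrees is a matter of symmetry. *)

Section ExponentialBounds.
Context {R : realType}.
Implicit Types x p a b : R.

(** From [1 - x <= expR (- x)] one gets [expR x <= (1 - x)^-1], and [(1 - x) (1 + x + 2 x^2) = 1 +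
    x^2 (1 - 2 x) >= 1]. *)
Lemma expR_le_quad x : `|x| <= 1 / 2 -> expR x <= 1 + x + 2 * x ^+ 2.
Proof.
rewrite ler_norml => /andP[lx ux].
have /le_trans -> // : expR x <= (1 - x)^-1.
  rewrite -[x in leLHS]opprK expRN lef_pV2 ?posrE ?expR_gt0//; last lra.
  exact: expR_ge1Dx.
rewrite -div1r ler_pdivrMr; last lra.
have : 0 <= x ^+ 2 by exact: sqr_ge0.
nra.
Qed.

(** The Taylor remainder has derivative [expR c - 1 - c], which lies between 0 and [2 c^2] by the
    previous bound; the mean value theorem supplies the third factor. *)
Lemma expR_taylor2 x : `|x| <= 1 / 2 ->
  `|expR x - (1 + x + x ^+ 2 / 2)| <= 2 * `|x| ^+ 3.
Proof.
move=> hx; pose f := fun y : R => expR y - (1 + y + y ^+ 2 / 2).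
pose df := fun y : R => expR y - (1 + y).
have fdf (y : R) : is_derive y 1 f (df y).
  apply: trigger_derive; rewrite /df /GRing.scale/=; field => //.
have cf : continuous f.
  by move=> z; apply/differentiable_continuous/derivable1_diffP; have [] := fdf z.
have f0 : f 0 = 0 by rewrite /f expR0; field.
suff [c cx fx] : exists2 c, `|c| <= `|x| & f x = df c * x.
  rewrite -/(f x) fx normrM exprSr mulrA ler_wpM2r//.
  have := expR_le_quad (le_trans cx hx); have := expR_ge1Dx c.
  have : c ^+ 2 <= `|x| ^+ 2.
    by rewrite -real_normK ?num_real// lerXn2r ?nnegrE.
  by rewrite /df ler_norml; move: (expR c) => u; nra.
have [x0|x0] := leP 0 x.
  have [c cx] := @MVT_segment _ f df 0 x x0 (fun y _ => fdf y)
    (continuous_subspaceT cf).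
  rewrite f0 !subr0 => fx; exists c => //.
  by move: cx; rewrite in_itv/= => /andP[? ?]; rewrite !ger0_norm.
have [c cx] := @MVT_segment _ f df x 0 (ltW x0) (fun y _ => fdf y)
  (continuous_subspaceT cf).
rewrite f0 !sub0r mulrN => /oppr_inj fx; exists c => //.
move: cx; rewrite in_itv/= => /andP[? ?].
by rewrite !ler0_norm ?lerN2// ltW.
Qed.

(** A Hoeffding lemma with a crude constant. After centring at the mean [m] the linear terms cancel,
    and the quadratic ones leave [2 p (1 - p) (a - b)^2 <= (a - b)^2]. *)
Lemma two_point_expR_le p a b : 0 <= p <= 1 -> `|a - b| <= 1 / 2 ->
  p * expR a + (1 - p) * expR b <= expR (p * a + (1 - p) * b + (a - b) ^+ 2).
Proof.
move=> /andP[p0 p1] hab; set m := p * a + (1 - p) * b; set u := a - b.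
have -> : a = m + (1 - p) * u by rewrite /m /u; ring.
have -> : b = m + (- p * u) by rewrite /m /u; ring.
move: hab; rewrite -/u; move: m u => m u hab.
rewrite !expRD mulrCA (mulrCA (1 - p)) -mulrDr ler_pM2l ?expR_gt0//.
have h1 : expR ((1 - p) * u) <= 1 + (1 - p) * u + 2 * ((1 - p) * u) ^+ 2.
  apply: expR_le_quad; rewrite normrM (le_trans _ hab)// ler_piMl//.
  by rewrite ger0_norm; lra.
have h2 : expR (- p * u) <= 1 + - p * u + 2 * (- p * u) ^+ 2.
  apply: expR_le_quad; rewrite normrM (le_trans _ hab)// ler_piMl//.
  by rewrite normrN ger0_norm; lra.
have h3 := expR_ge1Dx (u ^+ 2).
have h4 : 0 <= u ^+ 2 by exact: sqr_ge0.
have h5 : p * expR ((1 - p) * u) <=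
  p * (1 + (1 - p) * u + 2 * ((1 - p) * u) ^+ 2) by rewrite ler_wpM2l.
have h6 : (1 - p) * expR (- p * u) <=
  (1 - p) * (1 + - p * u + 2 * (- p * u) ^+ 2) by rewrite ler_wpM2l// subr_ge0.
have h7 : 2 * (p * (1 - p)) <= 1.
  have : 0 <= (2 * p - 1) ^+ 2 by exact: sqr_ge0.
  nra.
have : 2 * (p * (1 - p)) * u ^+ 2 <= 1 * u ^+ 2 by rewrite ler_wpM2r.
lra.
Qed.

End ExponentialBounds.

(** * Averaging out the coordinates of the biased cube one by one *)

Section Cube.
Context {R : realType} (I : finType) (p : R).
Hypothesis p01 : 0 <= p <= 1.
Local Notation cube := {ffun I -> bool}.
Implicit Types (i j : I) (s : seq I) (f g : cube -> R) (w : cube).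

Definition upd w i (b : bool) : cube := [ffun j => if j == i then b else w j].

Definition avg i f w := p * f (upd w i true) + (1 - p) * f (upd w i false).

Definition diff i f w := f (upd w i true) - f (upd w i false).

(* Conditional expectation given the coordinates outside [s]. *)
Fixpoint avgs s f := if s is i :: s' then avg i (avgs s' f) else f.

(* Sum of the squares of the predictable jumps of the martingale obtained by
   integrating out the coordinates of [s] one after the other. *)
Fixpoint qvar s f w :=
  if s is i :: s' then diff i (avgs s' f) w ^+ 2 + qvar s' f w else 0.

Definition indep i f := forall w b, f (upd w i b) = f w.

Definition lip i (c : R) f := forall w, `|diff i f w| <= c.

Let p0 : 0 <= p. Proof. by case/andP: p01. Qed.
Let p1 : 0 <= 1 - p. Proof. by case/andP: p01 => _; rewrite subr_ge0. Qed.

Lemma upd_upd w i b c : upd (upd w i b) i c = upd w i c.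
Proof. by apply/ffunP => j; rewrite !ffunE; case: eqP. Qed.

Lemma updC w i j b c : i != j -> upd (upd w i b) j c = upd (upd w j c) i b.
Proof.
move=> ij; apply/ffunP => x; rewrite !ffunE.
by case: eqP => // ->; rewrite eq_sym (negbTE ij).
Qed.

Lemma upd_same w i : upd w i (w i) = w.
Proof. by apply/ffunP => j; rewrite ffunE; case: eqP => // ->. Qed.

Lemma avg_ext i f g w : f =1 g -> avg i f w = avg i g w.
Proof. by move=> fg; rewrite /avg !fg. Qed.

Lemma avg_le i f g w : (forall w, f w <= g w) -> avg i f w <= avg i g w.
Proof. by move=> fg; rewrite /avg lerD// ler_wpM2l. Qed.

Lemma avgs_le s f g w : (forall w, f w <= g w) -> avgs s f w <= avgs s g w.
Proof. by move=> fg; elim: s w => [|i s IH] w //=; exact: avg_le. Qed.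

Lemma indep_avg_same i f : indep i (avg i f).
Proof. by move=> w b; rewrite /avg !upd_upd. Qed.

Lemma indep_diff_same i f : indep i (diff i f).
Proof. by move=> w b; rewrite /diff !upd_upd. Qed.

Lemma indep_avg i j f : indep j f -> indep j (avg i f).
Proof.
have [->|ij] := eqVneq i j; first by move=> _; exact: indep_avg_same.
by move=> fj w b; rewrite /avg ![upd (upd w j b) _ _]updC 1?eq_sym// !fj.
Qed.

Lemma indep_diff i j f : indep j f -> indep j (diff i f).
Proof.
have [->|ij] := eqVneq i j; first by move=> _; exact: indep_diff_same.
by move=> fj w b; rewrite /diff ![upd (upd w j b) _ _]updC 1?eq_sym// !fj.
Qed.

(** This makes the jumps predictable: the jump at [i] in [qvar] depends on no coordinate of
    [i :: s], so it can be pulled out of the averages. *)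
Lemma indep_avgs s i f : i \in s -> indep i (avgs s f).
Proof.
elim: s => [//|j s IH]; rewrite inE => /orP[/eqP ->|/IH is_]/=.
  exact: indep_avg_same.
exact: indep_avg.
Qed.

Lemma avg_pull i f g w : indep i g -> avg i (fun w =>
  g w * f w) w = g w * avg i f w.
Proof. by move=> gi; rewrite /avg !gi; ring. Qed.

Lemma avgs_ext s f g w : f =1 g -> avgs s f w = avgs s g w.
Proof. by move=> fg; elim: s w => [|i s IH] w /=; [exact: fg|exact: avg_ext]. Qed.

Lemma avgs_pull s f g w : {in s, forall i, indep i g} ->
  avgs s (fun w => g w * f w) w = g w * avgs s f w.
Proof.
elim: s w => [//|i s IH] w gs /=.
rewrite -(avg_pull _ _ (gs i (mem_head _ _))).
by apply: avg_ext => v; apply: IH => j js; apply: gs; rewrite inE js orbT.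
Qed.

Lemma avgsZ s (c : R) f w : avgs s (fun w => c * f w) w = c * avgs s f w.
Proof. exact: (@avgs_pull s f (fun=> c)). Qed.

Lemma lip_ge0 i c f : lip i c f -> 0 <= c.
Proof. by move=> /(_ [ffun=> true]); exact: le_trans. Qed.

Lemma lip_avg i j c f : lip j c f -> lip j c (avg i f).
Proof.
move=> fc w; have [->|ij] := eqVneq i j.
  by rewrite /diff !indep_avg_same subrr normr0 (lip_ge0 fc).
have -> : diff j (avg i f) w = avg i (diff j f) w.
  by rewrite /diff /avg ![upd (upd w j _) _ _]updC 1?eq_sym//; ring.
rewrite /avg (le_trans (ler_normD _ _))// !normrM (ger0_norm p0) (ger0_norm p1).
have -> : c = p * c + (1 - p) * c by ring.
by rewrite lerD// ler_wpM2l//; exact: fc.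
Qed.

Lemma lip_avgs s j c f : lip j c f -> lip j c (avgs s f).
Proof. by move=> fc; elim: s => [//|i s IH] /=; exact: lip_avg. Qed.

(** Supermartingale property, by induction on the coordinates: the squared jump at [i] is constant
    for the averages over [i :: s], the induction hypothesis bounds the inner average, and
    [two_point_expR_le] along [i] produces exactly the squared jump that was subtracted. *)
Lemma avgs_expR_sub_qvar s f w : uniq s -> {in s, forall i, lip i (1 / 2) f} ->
  avgs s (fun w => expR (f w - qvar s f w)) w <= expR (avgs s f w).
Proof.
elim: s w => [|i s IH] w /=; first by rewrite subr0.
move=> /andP[is_ us] fs; set h := diff i (avgs s f).
have hi : indep i (fun w => expR (- h w ^+ 2)).
  by move=> v b; rewrite /h indep_diff_same.
have hs : {in s, forall j, indep j (fun w => expR (- h w ^+ 2))}.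
  by move=> j js v b; rewrite /h (indep_diff _ (indep_avgs _ js)).
have -> : avg i (avgs s (fun w => expR (f w - (h w ^+ 2 + qvar s f w)))) w =
  expR (- h w ^+ 2) * avg i (avgs s (fun w => expR (f w - qvar s f w))) w.
  rewrite -(avg_pull _ _ hi); apply: avg_ext => v; rewrite -(avgs_pull _ _ hs).
  by apply: avgs_ext => {}v; rewrite -expRD; congr expR; ring.
have fs' : {in s, forall i, lip i (1 / 2) f}.
  by move=> j js; apply: fs; rewrite inE js orbT.
apply: (@le_trans _ _ (expR (- h w ^+ 2) * avg i (fun w => expR (avgs s f w)) w)).
  by rewrite ler_pM2l ?expR_gt0//; apply: avg_le => v; exact: IH.
rewrite -ler_pdivlMl ?expR_gt0// -expRN opprK -expRD addrC.
apply: two_point_expR_le => //.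
have lf : lip i (1 / 2) f by apply: fs; rewrite mem_head.
exact: (lip_avgs s lf).
Qed.

Lemma qvar_le s f w (c : I -> R) : {in s, forall i, lip i (c i) f} ->
  qvar s f w <= \sum_(i <- s) c i ^+ 2.
Proof.
elim: s => [|i s IH] fc /=; first by rewrite big_nil.
rewrite big_cons lerD ?IH//; last by move=> j js; apply: fc; rewrite inE js orbT.
rewrite -real_normK ?num_real// lerXn2r ?nnegrE//.
  by apply: (@lip_ge0 i _ f); apply: fc; rewrite mem_head.
by apply: (lip_avgs s); apply: fc; rewrite mem_head.
Qed.

(** Bounded-differences inequality: the compensator is replaced by its deterministic bound. *)
Lemma avgs_expR_le s f w (c : I -> R) : uniq s ->
  {in s, forall i, lip i (c i) f} -> {in s, forall i, c i <= 1 / 2} ->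
  avgs s (expR \o f) w <= expR (avgs s f w + \sum_(i <- s) c i ^+ 2).
Proof.
move=> us fc c2; set C := \sum_(i <- s) _.
have fs : {in s, forall i, lip i (1 / 2) f}.
  by move=> i is_ v; exact: le_trans (fc i is_ v) (c2 i is_).
apply: (@le_trans _ _ (expR C * avgs s (fun w => expR (f w - qvar s f w)) w)).
  rewrite -avgsZ; apply: avgs_le => v /=; rewrite -expRD ler_expR.
  by have := qvar_le v fc; rewrite -/C; lra.
by rewrite expRD mulrC ler_pM2r ?expR_gt0//; exact: avgs_expR_sub_qvar.
Qed.

(** Efron-Stein in martingale form: averaging over [i] adds [p (1 - p)] times the squared jump to
    the square of the mean, and [p (1 - p) <= 1]. *)
Lemma avgs_sqr_le s f w (c : I -> R) : {in s, forall i, lip i (c i) f} ->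
  avgs s (fun w => f w ^+ 2) w <= avgs s f w ^+ 2 + \sum_(i <- s) c i ^+ 2.
Proof.
elim: s w => [|i s IH] w fc /=; first by rewrite big_nil addr0.
have fs : {in s, forall i, lip i (c i) f}.
  by move=> j js; apply: fc; rewrite inE js orbT.
rewrite big_cons; set C := \sum_(i <- s) _.
have h : `|diff i (avgs s f) w| <= c i.
  by apply: (lip_avgs s); apply: fc; rewrite mem_head.
have {h} : diff i (avgs s f) w ^+ 2 <= c i ^+ 2.
  by rewrite -real_normK ?num_real// lerXn2r ?nnegrE ?(le_trans _ h).
have := @avg_le i _ _ w (fun w => IH w fs); rewrite -/C.
rewrite /avg /diff; move: (avgs s f _) (avgs s f _) => a b.
have : p * (1 - p) <= 1 by nra.
have := sqr_ge0 (a - b).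
have := mulr_ge0 p0 p1.
nra.
Qed.

Definition weight w := \prod_i (if w i then p else 1 - p).

Definition Ex f := \sum_w weight w * f w.

Lemma weight_ge0 w : 0 <= weight w.
Proof. by apply: prodr_ge0 => i _; case: ifP. Qed.

Lemma sum_weight : \sum_w weight w = 1.
Proof.
rewrite -(bigA_distr_bigA (fun _ (b : bool) => if b then p else 1 - p)).
by apply: big1 => i _; rewrite big_bool/=; ring.
Qed.

Lemma Ex_cst (c : R) : Ex (fun=> c) = c.
Proof. by rewrite /Ex -mulr_suml sum_weight mul1r. Qed.

Lemma ExZ (c : R) f : Ex (fun w => c * f w) = c * Ex f.
Proof. by rewrite /Ex mulr_sumr; apply: eq_bigr => w _; ring. Qed.

Lemma ExD f g : Ex (fun w => f w + g w) = Ex f + Ex g.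
Proof. by rewrite /Ex -big_split; apply: eq_bigr => w _; rewrite mulrDr. Qed.

Lemma Ex_sum (J : Type) (r : seq J) (Q : pred J) (F : J -> cube -> R) :
  Ex (fun w => \sum_(j <- r | Q j) F j w) = \sum_(j <- r | Q j) Ex (F j).
Proof.
by rewrite /Ex exchange_big/=; apply: eq_bigr => w _; rewrite mulr_sumr.
Qed.

Lemma Ex_le f g : (forall w, f w <= g w) -> Ex f <= Ex g.
Proof. by move=> fg; apply: ler_sum => w _; rewrite ler_wpM2l ?weight_ge0. Qed.

Lemma Ex_ext f g : f =1 g -> Ex f = Ex g.
Proof. by move=> fg; apply: eq_bigr => w _; rewrite fg. Qed.

(** The points of the cube pair up along [i], each pair being represented by its member with [w i]
    true. In this form averaging over [i] visibly preserves the expectation. *)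
Lemma Ex_pair i f : Ex f = \sum_(w : cube | w i)
  (\prod_(j | j != i) (if w j then p else 1 - p)) *
  (p * f (upd w i true) + (1 - p) * f (upd w i false)).
Proof.
rewrite /Ex (bigID (fun w : cube => w i))/=.
rewrite [X in _ + X](reindex_onto (fun w => upd w i false) (fun w =>
  upd w i true))/=; last first.
  by move=> w wi; rewrite upd_upd -(negbTE wi) upd_same.
rewrite [X in _ + X](eq_bigl (fun w : cube => w i)); last first.
  move=> w; rewrite upd_upd ffunE eqxx /=; apply/eqP/idP => [<-|wi].
    by rewrite ffunE eqxx.
  by rewrite -[in RHS](upd_same w i) wi.
rewrite -big_split/=; apply: eq_bigr => w wi.
have weightE v : weight v =
    (if v i then p else 1 - p) * \prod_(j | j != i) (if v j then p else 1 - p).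
  by rewrite /weight (bigD1 i).
rewrite !weightE ffunE eqxx wi -[in X in f X](upd_same w i) wi.
rewrite [in X in _ + X](eq_bigr (fun j => if w j then p else 1 - p)); last first.
  by move=> j ji; rewrite ffunE (negbTE ji).
by ring.
Qed.

Lemma Ex_avg i f : Ex (avg i f) = Ex f.
Proof.
rewrite !(Ex_pair i); apply: eq_bigr => w wi.
by rewrite !indep_avg_same /avg; ring.
Qed.

Lemma Ex_avgs s f : Ex (avgs s f) = Ex f.
Proof. by elim: s => [//|i s IH] /=; rewrite Ex_avg. Qed.

(** With every coordinate averaged out the function is constant, hence equal to its own mean. The
    unconditional bounds below are read off from the conditional ones in this way. *)
Lemma avgs_enum f w : avgs (enum I) f w = Ex f.
Proof.
suff h v : avgs (enum I) f v = avgs (enum I) f w.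
  by rewrite -(Ex_avgs (enum I)) -[LHS]Ex_cst; apply: Ex_ext => v; rewrite h.
(* The coordinates of [v] are replaced by those of [w] one at a time along [s]. *)
suff h s : avgs (enum I) f [ffun i => if i \in s then w i else v i] =
           avgs (enum I) f v.
  by rewrite -(h (enum I)); congr avgs; apply/ffunP => i; rewrite ffunE mem_enum.
elim: s => [|i s <-]; first by congr avgs; apply/ffunP => i; rewrite ffunE.
rewrite -[RHS](indep_avgs f (mem_enum _ i) _ (w i)); congr avgs.
by apply/ffunP => j; rewrite !ffunE inE; case: eqVneq => [->|].
Qed.

Lemma Ex_expR_le f (c : I -> R) : (forall i, lip i (c i) f) ->
  (forall i, c i <= 1 / 2) ->
  Ex (expR \o f) <= expR (Ex f + \sum_i c i ^+ 2).
Proof.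
move=> fc c2; have w : cube := [ffun=> true].
rewrite -(avgs_enum _ w) -(avgs_enum f w) -big_enum.
by apply: avgs_expR_le => //; exact: enum_uniq.
Qed.

Lemma Ex_sqr_le f (c : I -> R) : (forall i, lip i (c i) f) ->
  Ex (fun w => f w ^+ 2) <= Ex f ^+ 2 + \sum_i c i ^+ 2.
Proof.
move=> fc; have w : cube := [ffun=> true].
rewrite -(avgs_enum _ w) -(avgs_enum f w) -big_enum.
exact: avgs_sqr_le.
Qed.

Lemma Ex_expR_sub_qvar f : (forall i, lip i (1 / 2) f) ->
  Ex (fun w => expR (f w - qvar (enum I) f w)) <= expR (Ex f).
Proof.
move=> fs; have w : cube := [ffun=> true].
rewrite -(avgs_enum _ w) -(avgs_enum f w).
by apply: avgs_expR_sub_qvar => //; exact: enum_uniq.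
Qed.

End Cube.

(** * Exponential moments from first and second differences *)

Section SecondOrder.
Context {R : realType} (I : finType) (p : R).
Hypothesis p01 : 0 <= p <= 1.
Local Notation cube := {ffun I -> bool}.
Implicit Types (i m : I) (s : seq I) (f g : cube -> R) (w : cube).

(** Through this commutation, bounds on the second differences of [f] carry over to the martingale
    jumps. *)
Lemma diff_avgs s m f w : m \notin s ->
  diff m (avgs p s f) w = avgs p s (diff m f) w.
Proof.
elim: s w => [//|i s IH] w; rewrite inE negb_or => /andP[mi ms] /=.
rewrite [RHS]/avg -!IH// /diff /avg ![upd (upd w i _) m _]updC 1?eq_sym//.
by ring.
Qed.

Lemma Ex_prod (g : I -> bool -> R) :
  Ex p (fun w => \prod_i g i (w i)) =
  \prod_i (p * g i true + (1 - p) * g i false).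
Proof.
rewrite /Ex (eq_bigr (fun w : cube =>
  \prod_i ((if w i then p else 1 - p) * g i (w i)))).
  rewrite -(bigA_distr_bigA (fun i b => (if b then p else 1 - p) * g i b)).
  by apply: eq_bigr => i _; rewrite big_bool.
by move=> w _; rewrite /weight big_split.
Qed.

Context (f : cube -> R) (b : R) (c : I -> I -> R).
Hypothesis f_lip : forall m, lip m b f.
Hypothesis df_lip : forall m i, lip i (c m i) (diff m f).

(** A difference of squared jumps is the difference of the jumps, at most [c m i], times their sum,
    at most [2 b]. *)
Lemma lip_qvar s i : uniq s -> lip i (\sum_(m <- s) 2 * b * c m i) (qvar p s f).
Proof.
elim: s => [|m s IH] us w /=; first by rewrite big_nil /diff subrr normr0.
move: us => /= /andP[ms us]; rewrite big_cons.
set H := diff m (avgs p s f).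
have -> : diff i (fun w => H w ^+ 2 + qvar p s f w) w =
   diff i H w * (H (upd w i true) + H (upd w i false)) + diff i (qvar p s f) w.
  by rewrite /diff; ring.
rewrite (le_trans (ler_normD _ _))// lerD ?IH// normrM mulrC.
have Hb v : `|H v| <= b by apply: (lip_avgs p01).
have Hc : `|diff i H w| <= c m i.
  have -> : diff i H w = diff i (avgs p s (diff m f)) w.
    by rewrite /diff /H !diff_avgs.
  exact: (lip_avgs p01).
apply: ler_pM => //.
by rewrite (le_trans (ler_normD _ _))// mulr_natl mulr2n lerD.
Qed.

(** Each jump is a conditional expectation of [diff m f], so it has mean zero; its second moment is
    pure variance, which Efron-Stein bounds by second differences. *)
Lemma Ex_qvar_le s : uniq s -> (forall m, Ex p (diff m f) = 0) ->
  Ex p (qvar p s f) <= \sum_(m <- s) \sum_i c m i ^+ 2.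
Proof.
move=> us df0; elim: s us => [|m s IH] us; first by rewrite /= Ex_cst big_nil.
move: us => /= /andP[ms us]; rewrite big_cons ExD lerD ?IH//.
have -> : Ex p (fun w => diff m (avgs p s f) w ^+ 2) =
          Ex p (fun w => avgs p s (diff m f) w ^+ 2).
  by apply: Ex_ext => w; rewrite diff_avgs.
apply: le_trans (Ex_sqr_le p01 (fun i => lip_avgs p01 s (df_lip m i))) _.
by rewrite Ex_avgs df0 expr0n/= add0r.
Qed.

(** [expR (f - V)] is controlled by the supermartingale, and [expR V] by bounded differences, [C]
    being a bound for those of [V]. Separating the two factors is what halves [f]. *)
Lemma Ex_expR_half_le (C : R) : b <= 1 / 2 -> Ex p f = 0 ->
  (forall m, Ex p (diff m f) = 0) ->
  (forall i, \sum_m 2 * b * c m i <= C) -> C <= 1 / 2 ->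
  Ex p (fun w => expR (f w / 2)) <=
  expR (\sum_m \sum_i c m i ^+ 2 + #|I|%:R * C ^+ 2).
Proof.
move=> b2 f0 df0 cC C2; set V := qvar p (enum I) f; set B := _ + _.
have V_lip i : lip i (\sum_m 2 * b * c m i) V.
  by rewrite -big_enum; apply: lip_qvar; exact: enum_uniq.
have EV : Ex p (fun w => expR (V w)) <= expR B.
  have V_lip' i : lip i C V by move=> w; exact: le_trans (V_lip i w) (cC i).
  apply: le_trans (Ex_expR_le p01 V_lip' (fun=> C2)) _.
  rewrite ler_expR sumr_const -[_ *+ #|I|]mulr_natl lerD2r -big_enum.
  by apply: Ex_qvar_le => //; exact: enum_uniq.
have B0 : 0 <= B.
  rewrite addr_ge0//; last by rewrite mulr_ge0 ?sqr_ge0.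
  by apply: sumr_ge0 => m _; apply: sumr_ge0 => i _; exact: sqr_ge0.
have EfV : Ex p (fun w => expR (f w - V w)) <= expR B.
  apply: (@le_trans _ _ (expR 0)); last by rewrite ler_expR.
  rewrite -{1}f0; apply: Ex_expR_sub_qvar => // i w.
  exact: le_trans (f_lip i w) b2.
(* Cauchy-Schwarz takes the form [x y <= (x^2 + y^2) / 2], which loses nothing because both
   expectations are bounded by the same [expR B]. *)
apply: (@le_trans _ _ (Ex p (fun w => 2^-1 * (expR (f w - V w) + expR (V w))))).
  apply: Ex_le => // w; set x := expR ((f w - V w) / 2); set y := expR (V w / 2).
  have -> : expR (f w / 2) = x * y by rewrite -expRD; congr expR; field.
  have -> : expR (f w - V w) = x ^+ 2.
    by rewrite -expRM_natl; congr expR; field.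
  have -> : expR (V w) = y ^+ 2 by rewrite -expRM_natl; congr expR; field.
  by have := sqr_ge0 (x - y); nra.
by rewrite ExZ ExD; lra.
Qed.

End SecondOrder.

(** * The nonlinear remainder of the count of a regular family of sets *)

Section SetFamily.
Context {R : realType} (I J : finType) (K : J -> {set I}) (k D D2 : nat) (p : R).
Hypothesis p01 : 0 <= p <= 1.
Hypothesis card_K : forall j, #|K j| = k.
Hypothesis degree_K : forall i, #|[set j | i \in K j]%SET| = D.
Hypothesis codegree_K : forall i m, i != m ->
  (#|[set j | (i \in K j) && (m \in K j)]%SET| <= D2)%N.
Local Notation cube := {ffun I -> bool}.
Implicit Types (i m : I) (w : cube).

(** Sets count with the multiplicity with which [K] takes them: embeddings that differ by an
    automorphism have the same edges. *)
Definition family_count w : R :=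
  \sum_j (\prod_(i in K j) (w i)%:R - p ^+ k).

Definition linear_part w : R := \sum_i ((w i)%:R - p).

(* The part of [family_count] of order at least two in its Hoeffding
   decomposition. *)
Definition remainder w : R :=
  \sum_j (\prod_(i in K j) (w i)%:R - p ^+ k -
          p ^+ k.-1 * \sum_(i in K j) ((w i)%:R - p)).

(** Zero on the diagonal because a second difference in one and the same coordinate vanishes; the
    values bound the mixed second differences of [remainder]. *)
Definition codegree m i : nat :=
  if i == m then 0%N else #|[set j | (i \in K j) && (m \in K j)]%SET|.

Lemma family_count_decomp w :
  family_count w = D%:R * p ^+ k.-1 * linear_part w + remainder w.
Proof.
have -> : D%:R * p ^+ k.-1 * linear_part w =
    \sum_j p ^+ k.-1 * \sum_(i in K j) ((w i)%:R - p).
  rewrite -mulr_sumr mulrAC mulrC; congr (_ * _).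
  rewrite (exchange_big_dep predT)//= mulr_sumr; apply: eq_bigr => i _.
  rewrite sumr_const -[RHS]mulr_natl; congr (_%:R * _).
  by rewrite -(degree_K i); apply: eq_card => j; rewrite inE.
by rewrite /family_count /remainder -big_split/=; apply: eq_bigr => j _; ring.
Qed.

Lemma prod_upd (A : {set I}) m w (x : bool) :
  \prod_(i in A) ((upd w m x) i)%:R =
  (if m \in A then x%:R else 1) * \prod_(i in A :\ m) (w i)%:R :> R.
Proof.
case: ifPn => mA.
  rewrite (big_setD1 m)//= ffunE eqxx; congr (_ * _).
  by apply: eq_bigr => i; rewrite !inE ffunE => /andP[/negbTE ->].
rewrite mul1r (_ : A :\ m = A); last first.
  by apply/setP => i; rewrite !inE; case: eqVneq => [->|//]; rewrite (negbTE mA).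
by apply: eq_bigr => i iA; rewrite ffunE; case: eqP iA mA => // -> ->.
Qed.

Lemma sum_upd (A : {set I}) m w (x : bool) :
  \sum_(i in A) (((upd w m x) i)%:R - p) =
  (if m \in A then x%:R - p else 0) + \sum_(i in A :\ m) ((w i)%:R - p).
Proof.
case: ifPn => mA.
  rewrite (big_setD1 m)//= ffunE eqxx; congr (_ + _).
  by apply: eq_bigr => i; rewrite !inE ffunE => /andP[/negbTE ->].
rewrite add0r (_ : A :\ m = A); last first.
  by apply/setP => i; rewrite !inE; case: eqVneq => [->|//]; rewrite (negbTE mA).
by apply: eq_bigr => i iA; rewrite ffunE; case: eqP iA mA => // -> ->.
Qed.

(** The linear term subtracts [p^(k-1)], the mean of each surviving product; so the first
    differences of [remainder] are centred, as [Ex_qvar_le] requires. *)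
Lemma diff_remainder m w :
  diff m remainder w =
  \sum_(j | m \in K j) (\prod_(i in K j :\ m) (w i)%:R - p ^+ k.-1).
Proof.
rewrite /diff /remainder -sumrB [RHS]big_mkcond/=; apply: eq_bigr => j _.
by rewrite !prod_upd !sum_upd; case: ifP => _ /=; ring.
Qed.

Lemma diff_diff_remainder m i w : diff i (diff m remainder) w =
  if i == m then 0 else
  \sum_(j | (i \in K j) && (m \in K j)) \prod_(x in K j :\ m :\ i) (w x)%:R.
Proof.
rewrite {1}/diff !diff_remainder -sumrB.
have [->|im] := eqVneq i m.
  rewrite big1// => j mj; rewrite !prod_upd !inE eqxx/=; ring.
rewrite big_mkcond [RHS]big_mkcond/=; apply: eq_bigr => j _.
rewrite !prod_upd !inE im/= andbC.
by case: (m \in K j) => //=; case: (i \in K j); ring.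
Qed.

Lemma prod_bool01 (A : {set I}) w : 0 <= (\prod_(i in A) (w i)%:R : R) <= 1.
Proof.
apply/andP; split; first by apply: prodr_ge0.
by apply: prodr_ile1 => i _; rewrite ler0n/= lern1; case: (w i).
Qed.

Lemma lip_remainder m : lip m D%:R remainder.
Proof.
move=> w; rewrite diff_remainder (le_trans (ler_norm_sum _ _ _))//.
rewrite -(degree_K m) -sum1_card natr_sum.
under [leRHS]eq_bigl do rewrite inE.
apply: ler_sum => j _; have /andP[h0 h1] := prod_bool01 (K j :\ m) w.
have [q0 q1] : 0 <= p ^+ k.-1 /\ p ^+ k.-1 <= 1.
  by case/andP: p01 => p0 p1; split; [exact: exprn_ge0|exact: exprn_ile1].
by rewrite ler_norml; apply/andP; split; lra.
Qed.

Lemma lip_diff_remainder m i : lip i (codegree m i)%:R (diff m remainder).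
Proof.
move=> w; rewrite diff_diff_remainder /codegree.
case: ifPn => _; first by rewrite normr0.
rewrite (le_trans (ler_norm_sum _ _ _))// -sum1_card natr_sum.
under [leRHS]eq_bigl do rewrite inE.
by apply: ler_sum => j _; have /andP[h0 h1] := prod_bool01 (K j :\ m :\ i) w;
  rewrite ger0_norm.
Qed.

(** Double counting: each of the [D] members through [i] has [k - 1] other elements. *)
Lemma sum_codegree i : (\sum_m codegree m i = k.-1 * D)%N.
Proof.
rewrite (eq_bigr (fun m => \sum_(j | i \in K j) (m \in K j :\ i))%N).
  rewrite exchange_big/= (eq_bigr (fun=> k.-1)) => [|j ij].
    by rewrite sum_nat_const mulnC -(degree_K i); congr (_ * _)%N;
      apply: eq_card => j; rewrite inE.
  rewrite -(card_K j) (cardsD1 i (K j)) ij add1n /= -sum1_card [RHS]big_mkcond/=.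
  by apply: eq_bigr => m _; case: (m \in _).
move=> m _; rewrite /codegree; case: eqVneq => [->|im].
  by rewrite big1// => j _; rewrite !inE eqxx.
rewrite -sum1_card big_mkcond [RHS]big_mkcond/=; apply: eq_bigr => j _.
by rewrite !inE [m == i]eq_sym (negbTE im)/=; case: (i \in K j); case: (m \in K j).
Qed.

Lemma codegree_le m i : (codegree m i <= D2)%N.
Proof. by rewrite /codegree; case: eqVneq => // im; exact: codegree_K. Qed.

Lemma Ex_prod_set (A : {set I}) :
  Ex p (fun w => \prod_(i in A) (w i)%:R) = p ^+ #|A|.
Proof.
rewrite -prodr_const [RHS]big_mkcond -[RHS](@eq_bigr _ _ _ _ _ _ (fun i =>
  p * (if i \in A then 1 else 1) + (1 - p) * (if i \in A then 0 else 1))).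
  rewrite -(@Ex_prod R I p (fun i b => if i \in A then b%:R else 1)).
  by apply: Ex_ext => w; rewrite big_mkcond.
by move=> i _; case: ifP => _; ring.
Qed.

Lemma Ex_diff_remainder m : Ex p (diff m remainder) = 0.
Proof.
rewrite (@Ex_ext _ _ _ _ _ (diff_remainder m)) Ex_sum big1// => j mj.
rewrite (ExD p (fun w => \prod_(i in K j :\ m) (w i)%:R) (fun=> - p ^+ k.-1)).
by rewrite Ex_cst Ex_prod_set -(card_K j) (cardsD1 m (K j)) mj subrr.
Qed.

Lemma Ex_coord i : Ex p (fun w => (w i)%:R - p) = 0.
Proof.
rewrite (ExD p (fun w => (w i)%:R) (fun=> - p)) Ex_cst.
have := Ex_prod_set [set i]%SET; rewrite cards1 expr1.
under Ex_ext do rewrite big_set1.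
by move=> ->; rewrite subrr.
Qed.

Lemma Ex_remainder : Ex p remainder = 0.
Proof.
rewrite /remainder Ex_sum big1// => j _.
rewrite (ExD p (fun w => \prod_(i in K j) (w i)%:R - p ^+ k)
  (fun w => - (p ^+ k.-1 * \sum_(i in K j) ((w i)%:R - p)))).
rewrite (ExD p (fun w => \prod_(i in K j) (w i)%:R) (fun=> - p ^+ k)).
rewrite Ex_cst Ex_prod_set card_K subrr add0r.
under Ex_ext do rewrite -mulNr.
by rewrite ExZ Ex_sum big1 ?mulr0// => i _; exact: Ex_coord.
Qed.

(** [Ex_expR_half_le] with [f = 2 t remainder], [b = 2 |t| D] and [C = 8 k (t D)^2]; the two
    hypotheses say [b <= 1/2] and [C <= 1/2]. In the sum of squared codegrees one factor is bounded
    by [D2] and the other is summed exactly. *)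
Lemma Ex_expR_remainder_le (t : R) : `|t| * D%:R <= 1 / 4 ->
  (t * D%:R) ^+ 2 * k%:R <= 1 / 16 ->
  Ex p (fun w => expR (t * remainder w)) <=
  expR (4 * k%:R * #|I|%:R * D2%:R * D%:R * t ^+ 2 +
        64 * k%:R ^+ 2 * #|I|%:R * D%:R ^+ 4 * t ^+ 4).
Proof.
move=> tD tk; pose f w := 2 * t * remainder w.
have df m w : diff m f w = 2 * t * diff m remainder w by rewrite /diff /f; ring.
have f_lip m : lip m (2 * `|t| * D%:R) f.
  move=> w; rewrite df normrM normrM ger0_norm//.
  by rewrite ler_wpM2l ?mulr_ge0//; exact: lip_remainder.
have df_lip m i : lip i (2 * `|t| * (codegree m i)%:R) (diff m f).
  move=> w; have -> : diff i (diff m f) w = 2 * t * diff i (diff m remainder) w.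
    by rewrite /diff /f; ring.
  rewrite normrM normrM [`|2|]ger0_norm//.
  by rewrite ler_wpM2l ?mulr_ge0//; exact: lip_diff_remainder.
have k1 : (k.-1 <= k)%N by rewrite leq_pred.
have := @Ex_expR_half_le R I p p01 f _ _ f_lip df_lip (8 * k%:R * (t * D%:R) ^+ 2).
have -> : Ex p (fun w => expR (f w / 2)) = Ex p (fun w => expR (t * remainder w)).
  by apply: Ex_ext => w; rewrite /f; congr expR; field.
move=> h; apply: le_trans (h _ _ _ _ _) _.
- by lra.
- by rewrite ExZ Ex_remainder mulr0.
- by move=> m; rewrite (Ex_ext p (df m)) ExZ Ex_diff_remainder mulr0.
- move=> i; rewrite -mulr_sumr -mulr_sumr -natr_sum sum_codegree natrM exprMn.
  rewrite -[t ^+ 2]real_normK ?num_real//.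
  have : (k.-1)%:R <= k%:R :> R by rewrite ler_nat.
  have : 0 <= (`|t| * D%:R) ^+ 2 by exact: sqr_ge0.
  by move: `|t| (k.-1)%:R => x y; nra.
- by lra.
rewrite ler_expR [X in _ + X](_ : _ =
  64 * k%:R ^+ 2 * #|I|%:R * D%:R ^+ 4 * t ^+ 4); last by ring.
rewrite lerD2r.
apply: (@le_trans _ _ (\sum_m \sum_i 4 * t ^+ 2 * D2%:R * (codegree m i)%:R)).
  apply: ler_sum => m _; apply: ler_sum => i _.
  rewrite [leLHS](_ : _ = 4 * `|t| ^+ 2 * (codegree m i)%:R ^+ 2); last by ring.
  rewrite real_normK ?num_real// -[leRHS]mulrA ler_wpM2l//.
    by rewrite mulr_ge0 ?sqr_ge0.
  by rewrite expr2 ler_wpM2r// ler_nat codegree_le.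
rewrite exchange_big/=; under eq_bigr do rewrite -mulr_sumr -natr_sum sum_codegree.
rewrite sumr_const -mulr_natl natrM.
rewrite [leLHS](_ : _ = 4 * #|I|%:R * D2%:R * D%:R * t ^+ 2 * (k.-1)%:R);
  last by ring.
rewrite [leRHS](_ : _ = 4 * #|I|%:R * D2%:R * D%:R * t ^+ 2 * k%:R); last by ring.
by rewrite ler_wpM2l ?ler_nat// mulr_ge0 ?sqr_ge0// !mulr_ge0.
Qed.

End SetFamily.

(** * Gaertner-Ellis theorem with a Gaussian limit *)

Section CumulantGeneratingFunction.
Context {R : realType} {T : finType} (wt : T -> R).
Hypothesis wt_ge0 : forall w, 0 <= wt w.
Hypothesis wt_sum : \sum_w wt w = 1.
Implicit Types f g : T -> R.

Definition cgf f : R := ln (\sum_w wt w * expR (f w)).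

Lemma mgf_gt0 f : 0 < \sum_w wt w * expR (f w).
Proof.
have h w : true -> 0 <= wt w * expR (f w) by rewrite mulr_ge0.
rewrite lt_neqAle sumr_ge0// andbT eq_sym psumr_eq0//.
apply/negP => /allP all0; have /eqP := wt_sum.
rewrite big1 ?(eq_sym 0) ?oner_eq0// => w _.
have := all0 w (mem_index_enum w).
by rewrite /= mulf_eq0 [expR _ == 0]gt_eqF ?expR_gt0// orbF => /eqP.
Qed.

Lemma expR_cgf f : expR (cgf f) = \sum_w wt w * expR (f w).
Proof. by rewrite lnK// posrE mgf_gt0. Qed.

Lemma cgf_ext f g : f =1 g -> cgf f = cgf g.
Proof. by move=> fg; congr ln; apply: eq_bigr => w _; rewrite fg. Qed.

Lemma cgf_le f c : \sum_w wt w * expR (f w) <= expR c -> cgf f <= c.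
Proof. by move=> h; rewrite -ler_expR expR_cgf. Qed.

(* Normalised so that both exponential moments are 1, Hoelder's inequality is
   the convexity of the exponential. *)
Lemma cgf_convex f g t : 0 <= t <= 1 ->
  cgf (fun w => t * f w + (1 - t) * g w) <= t * cgf f + (1 - t) * cgf g.
Proof.
move=> /andP[t0 t1]; apply: cgf_le.
move: (expR_cgf f) (expR_cgf g); move: (cgf f) (cgf g) => A B hA hB.
have hf : \sum_w wt w * expR (f w - A) = 1.
  under eq_bigr do rewrite expRD mulrA.
  by rewrite -mulr_suml -hA -expRD subrr expR0.
have hg : \sum_w wt w * expR (g w - B) = 1.
  under eq_bigr do rewrite expRD mulrA.
  by rewrite -mulr_suml -hB -expRD subrr expR0.
have -> : expR (t * A + (1 - t) * B) = expR (t * A + (1 - t) * B) *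
    (t * (\sum_w wt w * expR (f w - A)) +
     (1 - t) * \sum_w wt w * expR (g w - B)).
  by rewrite hf hg !mulr1 [t + _]addrC subrK mulr1.
rewrite 2!mulr_sumr -big_split/= mulr_sumr; apply: ler_sum => w _.
set x := f w - A; set y := g w - B.
have -> : t * f w + (1 - t) * g w =
    t * A + (1 - t) * B + (t * x + (1 - t) * y) by rewrite /x /y; ring.
rewrite expRD mulrCA ler_pM2l ?expR_gt0//.
rewrite mulrCA (mulrCA (1 - t)) -mulrDr ler_wpM2l//.
set m := t * x + (1 - t) * y.
have -> : expR x = expR m * expR (x - m) by rewrite -expRD; congr expR; ring.
have -> : expR y = expR m * expR (y - m) by rewrite -expRD; congr expR; ring.
rewrite mulrCA (mulrCA (1 - t)) -mulrDr -[leLHS]mulr1 ler_pM2l ?expR_gt0//.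
apply: (@le_trans _ _ (t * (1 + (x - m)) + (1 - t) * (1 + (y - m)))).
  by rewrite /m le_eqVlt; apply/orP; left; apply/eqP; ring.
by rewrite lerD// ler_wpM2l ?subr_ge0// expR_ge1Dx.
Qed.

End CumulantGeneratingFunction.

(** * Stability of a limiting cumulant generating function under perturbation *)

Section AsymptoticCgf.
Context {R : realType} (T : nat -> finType) (wt : forall n, T n -> R).
Hypothesis wt_ge0 : forall n w, 0 <= @wt n w.
Hypothesis wt_sum : forall n, \sum_w @wt n w = 1.
Context (s : nat -> R).
Hypothesis s_oo : s n @[n --> \oo] --> +oo.

Lemma speed_gt (c : R) : \forall n \near \oo, c < s n.
Proof. by move/cvgryPgt : s_oo; exact. Qed.

(** Here and in the next estimate [A], [F], [Y] stand for the normalised cgfs of [X], [X + Y] and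
    [Y] at the tilts chosen in [cgf_add_cvg], and [c] for the limit. *)
Let lower_arith (r c e A F Y : R) : 1 < r -> r <= 2 -> 0 < e -> 0 <= c ->
  (r - 1) * c <= e / 4 -> c * r^-1 ^+ 2 - e / 8 <= A -> Y <= e / 4 ->
  A <= r^-1 * F + (1 - r^-1) * Y -> c - e <= F.
Proof.
move=> r1 r2 e0 c0 rc hA hY hF.
have rr : r * r^-1 = 1 by rewrite mulfV// gt_eqF//; lra.
have {}hF : r * A <= F + (r - 1) * Y.
  have := ler_wpM2l (ltW (lt_trans ltr01 r1)) hF.
  rewrite mulrDr !mulrA rr mul1r mulrBr rr mulr1; exact.
have {}hA : c * r^-1 - r * (e / 8) <= r * A.
  have := ler_wpM2l (ltW (lt_trans ltr01 r1)) hA.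
  rewrite mulrBr (_ : r * (c * r^-1 ^+ 2) = c * r^-1 * (r * r^-1)); last by ring.
  by rewrite rr mulr1.
have h1 : (r - 1) * Y <= (r - 1) * (e / 4) by rewrite ler_wpM2l//; lra.
have h2 : (r - 1) * (e / 4) <= e / 4 by nra.
have h3 : r * (e / 8) <= e / 4 by nra.
have h4 : c - c * r^-1 <= e / 4.
  apply: le_trans rc.
  have -> : (r - 1) * c = (r - 1) * (c * 1) by rewrite mulr1.
  have -> : c - c * r^-1 = (r - 1) * (c * r^-1).
    by rewrite mulrBl mul1r mulrCA rr mulr1.
  rewrite ler_wpM2l//; first lra.
  by rewrite ler_wpM2l// invf_le1 ?(lt_trans _ r1)// ltW.
lra.
Qed.

Let upper_arith (r c e A F Y : R) : 1 < r -> r <= 2 -> 0 < e -> 0 <= c ->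
  (r - 1) * c <= e / 4 -> A <= c * r ^+ 2 + e / 8 -> Y <= e / 4 ->
  F <= r^-1 * A + (1 - r^-1) * Y -> F <= c + e.
Proof.
move=> r1 r2 e0 c0 rc hA hY hF.
have r0 : 0 < r by lra.
have rr : r^-1 * r = 1 by rewrite mulVf// gt_eqF.
have q0 : 0 < r^-1 by rewrite invr_gt0.
have q1 : r^-1 <= 1 by rewrite invf_le1// ltW.
have h1 : r^-1 * A <= c * r + r^-1 * (e / 8).
  have := ler_wpM2l (ltW q0) hA.
  rewrite mulrDr (_ : r^-1 * (c * r ^+ 2) = c * r * (r^-1 * r)); last by ring.
  by rewrite rr mulr1.
have h2 : (1 - r^-1) * Y <= (1 - r^-1) * (e / 4) by rewrite ler_wpM2l//; lra.
have h3 : (1 - r^-1) * (e / 4) <= e / 4 by nra.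
have h4 : r^-1 * (e / 8) <= e / 8 by nra.
lra.
Qed.

(** Convexity is used twice: [X + Y] is a convex combination of multiples of [X] and [Y], and a
    multiple of [X] is one of [X + Y] and a negative multiple of [Y]. Since [t] takes both signs,
    upper bounds on the cgf of [Y] serve both directions. *)
Lemma cgf_add_cvg (X Y : forall n, T n -> R) (v : R) : 0 <= v ->
  (forall t, (s n)^-1 * cgf (@wt n) (fun w => t * X n w) @[n --> \oo] -->
     v * t ^+ 2 / 2) ->
  (forall t e, 0 < e -> \forall n \near \oo,
     (s n)^-1 * cgf (@wt n) (fun w => t * Y n w) <= e) ->
  forall t, (s n)^-1 * cgf (@wt n) (fun w => t * (X n w + Y n w)) @[n --> \oo] -->
     v * t ^+ 2 / 2.
Proof.
move=> v0 hX hY t; apply/cvgrPdist_le => e e0.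
set c := v * t ^+ 2 / 2.
have c0 : 0 <= c by rewrite divr_ge0// mulr_ge0// sqr_ge0.
(* 1/r is the Hoelder weight given to X *)
have [r [r1 r2 rc]] : exists r : R, [/\ 1 < r, r <= 2 & (r - 1) * c <= e / 4].
  (* [r - 1] is [e / (4 (c + e))]: at most 1/4, with [(r - 1) c <= e / 4], and well defined when
     [c = 0]. *)
  have h : 0 < e / 4 / (c + e) by rewrite !divr_gt0//; lra.
  exists (1 + e / 4 / (c + e)); split; first lra.
    rewrite -lerBrDl ler_pdivrMr; last lra.
    by lra.
  rewrite addrAC subrr add0r mulrAC ler_pdivrMr; last lra.
  by nra.
have r0 : 0 < r by lra.
have t01 : 0 <= r^-1 <= 1.
  by rewrite invr_ge0 ltW//= invf_le1// ltW.
have tr : 0 < 1 - r^-1 by rewrite subr_gt0 invf_lt1.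
have rn0 : r != 0 by rewrite gt_eqF.
have tn0 : 1 - r^-1 != 0 by rewrite gt_eqF.
have e4 : 0 < e / 4 by lra.
have hX1 := hX (r * t); have hX2 := hX (t / r).
near=> n.
have s0 : 0 < s n by near: n; exact: speed_gt.
have si : 0 <= (s n)^-1 by rewrite invr_ge0 ltW.
rewrite ler_distlC; apply/andP; split.
  have b1 : v * (t / r) ^+ 2 / 2 - e / 8 <= (s n)^-1 * cgf (@wt n) (fun w =>
    t / r * X n w).
    by near: n; apply: (cvgr_ge _ hX2); lra.
  have b2 : (s n)^-1 * cgf (@wt n) (fun w =>
    - (r^-1 / (1 - r^-1)) * t * Y n w) <= e / 4.
    by near: n; apply: hY.
  have := @cgf_convex _ _ (@wt n) (@wt_ge0 n) (wt_sum n)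
    (fun w => t * (X n w + Y n w)) (fun w =>
      - (r^-1 / (1 - r^-1)) * t * Y n w) _ t01.
  rewrite (@cgf_ext _ _ _ _ (fun w => t / r * X n w)); last first.
    move=> w; set q := 1 - r^-1; have q0 : q != 0 by [].
    have -> : q * (- (r^-1 / q) * t * @Y n w) =
      - (r^-1 * t * @Y n w) * (q / q) by ring.
    by rewrite mulfV// mulr1 mulrDr mulrDr; ring.
  move=> /(ler_wpM2l si);
    rewrite mulrDr [_ * (r^-1 * _)]mulrCA [_ * ((1 - r^-1) * _)]mulrCA.
  apply: (lower_arith r1 r2 e0 c0 rc _ b2).
  by move: b1; rewrite expr_div_n /c exprVn; congr (_ - _ <= _); ring.
have b1 : (s n)^-1 * cgf (@wt n) (fun w =>
  r * t * X n w) <= v * (r * t) ^+ 2 / 2 + e / 8.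
  by near: n; apply: (cvgr_le _ hX1); lra.
have b2 : (s n)^-1 * cgf (@wt n) (fun w => (1 - r^-1)^-1 * t * Y n w) <= e / 4.
  by near: n; apply: hY.
have := @cgf_convex _ _ (@wt n) (@wt_ge0 n) (wt_sum n)
  (fun w => r * t * X n w) (fun w => (1 - r^-1)^-1 * t * Y n w) _ t01.
rewrite (@cgf_ext _ _ _ _ (fun w => t * (X n w + Y n w))); last first.
  by move=> w; rewrite !mulrA mulVf// mulfV// !mul1r mulrDr.
move=> /(ler_wpM2l si);
  rewrite mulrDr [_ * (r^-1 * _)]mulrCA [_ * ((1 - r^-1) * _)]mulrCA.
apply: (upper_arith r1 r2 e0 c0 rc _ b2).
by move: b1; rewrite exprMn /c; congr (_ <= _ + _); ring.
Unshelve. all: by end_near. Qed.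

End AsymptoticCgf.

(** * From Gaussian cumulant asymptotics to the large deviation principle *)

Section GaussianLDP.
Context {R : realType}.

Lemma lee_real_gt (a b : \bar R) :
  (forall y : R, (b < y%:E)%E -> (a <= y%:E)%E) -> (a <= b)%E.
Proof.
case: b => [b|_|h]; last 2 first.
- exact: leey.
- case: a h => [a| |]//.
    by move=> /(_ (a - 1) (ltNyr _)); rewrite lee_fin lerBrDr gerDl ler10.
  by move=> /(_ 0 (ltNyr _)).
move=> h; apply/lee_addgt0Pr => e e0; rewrite -EFinD; apply: h.
by rewrite lte_fin ltrDl.
Qed.

Lemma limn_esup_le_real (u : nat -> \bar R) (l : \bar R) :
  (forall y : R, (l < y%:E)%E -> \forall n \near \oo, (u n <= y%:E)%E) ->
  (limn_esup u <= l)%E.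
Proof.
move=> h; apply: lee_real_gt => y ly; rewrite /limn_esup limf_esupE.
apply: ge_ereal_inf; exists (ereal_sup (u @` [set n | (u n <= y%:E)%E])).
  by exists [set n | (u n <= y%:E)%E] => //; exact: h.
by apply: ge_ereal_sup => _ [n un <-].
Qed.

Lemma limn_einf_ge_real (u : nat -> \bar R) (l : \bar R) :
  (forall y : R, (l < y%:E)%E -> \forall n \near \oo, (- y%:E <= u n)%E) ->
  (- l <= limn_einf u)%E.
Proof.
move=> h; rewrite /limn_einf leeN2; apply: limn_esup_le_real => y ly.
by apply: filterS (h y ly) => n; rewrite leeNl.
Qed.

Context (T : nat -> finType) (wt : forall n, T n -> R).
Hypothesis wt_ge0 : forall n w, 0 <= @wt n w.
Hypothesis wt_sum : forall n, \sum_w @wt n w = 1.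
Context (s : nat -> R) (Z : forall n, T n -> R) (v : R).
Hypothesis s_oo : s n @[n --> \oo] --> +oo.
Hypothesis v_gt0 : 0 < v.
Hypothesis cgf_cvg : forall t,
  (s n)^-1 * cgf (@wt n) (fun w =>
    t * (s n * @Z n w)) @[n --> \oo] --> v * t ^+ 2 / 2.

Definition law n (A : set R) : R := \sum_w @wt n w * (`[< A (@Z n w) >])%:R.

Let C n t := cgf (@wt n) (fun w => t * (s n * @Z n w)).

Lemma law_le1 n A : law n A <= 1.
Proof.
rewrite -(wt_sum n); apply: ler_sum => w _.
by rewrite ler_piMr// lern1; case: asboolP.
Qed.

Lemma cgf_near t e : 0 < e -> \forall n \near \oo,
  s n * (v * t ^+ 2 / 2 - e) <= C n t <= s n * (v * t ^+ 2 / 2 + e).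
Proof.
move=> e0; near=> n; have s0 : 0 < s n by near: n; exact: speed_gt.
rewrite -(ler_pdivlMl _ _ s0) -(ler_pdivrMl _ _ s0) -ler_distlC; near: n.
by move/cvgrPdist_le : (@cgf_cvg t); exact.
Unshelve. all: by end_near. Qed.

Lemma chernoff n (A : set R) t c : 0 <= s n -> (forall x, A x -> c <= t * x) ->
  law n A <= expR (C n t - s n * c).
Proof.
move=> s0 h; rewrite expRD expR_cgf// mulr_suml; apply: ler_sum => w _.
rewrite -mulrA ler_wpM2l// -expRD; case: asboolP => [Aw|_]; last exact: expR_ge0.
rewrite -[leLHS]expR0 ler_expR.
by have := ler_wpM2l s0 (h _ Aw); lra.
Qed.

(** The slack [S e >= ln 2] pays for the factor 2 of a union bound over two half-lines. *)
Let half_expR (S e y y' c : R) : ln 2 <= S * e -> y' = y + 2 * e ->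
  c <= S * (y' + e) -> expR (c - S * (2 * y')) <= expR (- (S * y)) / 2.
Proof.
move=> Se -> hc; rewrite ler_pdivlMr// -ler_pdivlMl ?expR_gt0// -expRN -expRD.
by rewrite -[leLHS]lnK ?posrE// ler_expR; lra.
Qed.

(** [A] avoids [(-r, r)] with [r^2 = 2 v y'], so it is covered by two half-lines, each bounded by
    Chernoff at its optimal tilt [r / v] or [- r / v]. *)
Lemma law_upper (A : set R) (y y' : R) : 0 < y' -> y < y' ->
  (forall x, A x -> y' <= x ^+ 2 / (2 * v)) ->
  \forall n \near \oo, law n A <= expR (- (s n * y)).
Proof.
move=> y'0 yy' hA.
have vn0 : v != 0 by rewrite gt_eqF.
have [r [r0 r2]] : exists r, 0 < r /\ r ^+ 2 = 2 * v * y'.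
  exists (Num.sqrt (2 * v * y')); rewrite sqrtr_gt0 !mulr_gt0// sqr_sqrtr//.
  by rewrite !mulr_ge0 ?ltW.
have [t [t0 tv tr]] : exists t, [/\ 0 < t, v * t ^+ 2 / 2 = y' & t * r = 2 * y'].
  exists (r / v); split; first by rewrite divr_gt0.
    have -> : y' = r ^+ 2 / (2 * v) by rewrite r2; field.
    by field.
  by rewrite mulrAC -expr2 r2; field.
have [e [e0 ye]] : exists e, 0 < e /\ y' = y + 2 * e.
  by exists ((y' - y) / 2); split; [lra|field].
have h1 := cgf_near t e0; have h2 := cgf_near (- t) e0.
near=> n.
have s0 : 0 < s n by near: n; exact: speed_gt.
have se : ln 2 <= s n * e.
  rewrite -ler_pdivrMr//; apply: ltW; near: n; exact: speed_gt.
have /andP[_ c1] : s n * (v * t ^+ 2 / 2 - e) <= C n t <=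
  s n * (v * t ^+ 2 / 2 + e).
  by near: n.
have /andP[_ c2] : s n * (v * (- t) ^+ 2 / 2 - e) <= C n (- t) <=
  s n * (v * (- t) ^+ 2 / 2 + e).
  by near: n.
rewrite sqrrN in c2; rewrite tv in c1 c2.
have l1 : law n (A `&` [set x | r <= x]) <= expR (C n t - s n * (t * r)).
  by apply: chernoff; [exact: ltW|move=> x [_ rx]; rewrite ler_pM2l].
have l2 : law n (A `&` [set x | x <= - r]) <= expR (C n (- t) - s n * (t * r)).
  apply: chernoff; [exact: ltW|move=> x [_ rx]].
  by rewrite mulNr -mulrN ler_pM2l// lerNr.
rewrite tr in l1 l2.
have l3 : law n A <= law n (A `&` [set x | r <=
  x]) + law n (A `&` [set x | x <= - r]).
  rewrite /law -big_split/=; apply: ler_sum => w _; rewrite -mulrDr ler_wpM2l//.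
  case: asboolP => Aw; last by rewrite addr_ge0.
  have : r <= `|@Z n w|.
    rewrite -ler_sqr ?nnegrE ?normr_ge0 ?(ltW r0)// real_normK ?num_real// r2.
    by have := hA _ Aw; rewrite ler_pdivlMr ?mulr_gt0// mulrC.
  rewrite ler_normr => /orP[rZ|rZ].
    by rewrite asboolT// lerDl.
  have rZ' : (A `&` [set x | x <= - r]) (@Z n w) by split => //=; rewrite lerNr.
  by rewrite (asboolT rZ') lerDr.
have hE := half_expR se ye.
apply: le_trans l3 _; apply: le_trans (lerD l1 l2) _.
by apply: le_trans (lerD (hE _ c1) (hE _ c2)) _; rewrite -splitr.
Unshelve. all: by end_near. Qed.

(* The tilted measure with parameter [t] charges the complement of
   [(x - d, x + d)] by at most two further Chernoff bounds. *)
Lemma tilted_law_ge n (A : set R) x d t h : 0 <= s n -> 0 <= h ->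
  (forall z, `|z - x| < d -> A z) ->
  expR (C n t) - expR (C n (t + h) - s n * (h * (x + d)))
    - expR (C n (t - h) + s n * (h * (x - d)))
  <= expR (s n * (t * x + `|t| * d)) * law n A.
Proof.
move=> s0 h0 dA; rewrite [X in _ - X - _]expRD [X in _ - _ - X]expRD !expR_cgf//.
rewrite !mulr_suml mulr_sumr -!sumrB; apply: ler_sum => w _.
rewrite -![wt w * expR _ * _]mulrA -!mulrBr [leRHS]mulrCA -!expRD ler_wpM2l//.
move: (@Z n w) => z.
have [zd|zd] := ltP `|z - x| d.
  rewrite asboolT ?mulr1; last exact: dA.
  apply: (@le_trans _ _ (expR (t * (s n * z)))).
    by rewrite -addrA gerDl -opprD oppr_le0 addr_ge0// expR_ge0.
  rewrite ler_expR mulrCA ler_wpM2l//.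
  have : t * (z - x) <= `|t| * d.
    by rewrite (le_trans (ler_norm _))// normrM ler_wpM2l// ltW.
  lra.
(* Outside the window one of the two subtracted exponentials is at least the first one, according to
   the side of [x] on which [z] lies. *)
apply: (@le_trans _ _ 0); last by rewrite mulr_ge0 ?expR_ge0.
rewrite -addrA -opprD subr_le0.
move: zd; rewrite ler_normr => /orP[zd|zd].
  rewrite -[leLHS]addr0 lerD ?expR_ge0// ler_expR.
  have := ler_wpM2l (mulr_ge0 s0 h0) zd; lra.
rewrite -[leLHS]add0r lerD ?expR_ge0// ler_expR.
have := ler_wpM2l (mulr_ge0 s0 h0) zd; lra.
Qed.

(** The tilt [t = x / u] centres the Gaussian at [x], and [h = d / u] is the optimal Chernoff
    parameter for leaving the window: both escape exponents fall short of the main one by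
    [S d^2 / (2 u)], at least [4 S f]. The errors of the cgfs take [2 S f] and [ln 4] takes at most
    [S f], so each escape term is at most a quarter of the main term. *)
Let lower_expR (S u x d td e f C0 C1 C2 L : R) (t := x / u) (h := d / u) :
  0 < S -> u != 0 -> ln 4 <= S * f -> f <= e -> 4 * f <= d ^+ 2 / (2 * u) ->
  td <= e -> S * (u * t ^+ 2 / 2 - f) <= C0 ->
  C1 <= S * (u * (t + h) ^+ 2 / 2 + f) -> C2 <= S * (u * (t - h) ^+ 2 / 2 + f) ->
  expR C0 - expR (C1 - S * (h * (x + d))) - expR (C2 + S * (h * (x - d))) <=
    expR (S * (t * x + td)) * L ->
  expR (- (S * (x ^+ 2 / (2 * u) + 4 * e))) <= L.
Proof.
move=> S0 u0 Sf fe fd tde hC0 hC1 hC2 key.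
pose m := x ^+ 2 / (2 * u); pose g := d ^+ 2 / (2 * u).
have m0 : u * t ^+ 2 / 2 = m by rewrite /t /m; field.
have m1 : u * (t + h) ^+ 2 / 2 - h * (x + d) = m - g by rewrite /t /h /m /g; field.
have m2 : u * (t - h) ^+ 2 / 2 + h * (x - d) = m - g by rewrite /t /h /m /g; field.
have m3 : t * x = 2 * m by rewrite /t /m; field.
have Sfg : S * (4 * f) <= S * g by rewrite ler_pM2l.
have Sfe : S * f <= S * e by rewrite ler_pM2l.
have Std : S * td <= S * e by rewrite ler_pM2l.
have l4 : 0 <= ln 4 :> R by rewrite ln_ge0// ler1n.
rewrite -/m; move: key hC0; rewrite m0 m3; move: m0 m1 m2 m3 => _ m1 m2 _.
have {}m1 : S * (u * (t + h) ^+ 2 / 2) - S * (h * (x + d)) = S * m - S * g.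
  by rewrite -!mulrBr m1.
have {}m2 : S * (u * (t - h) ^+ 2 / 2) + S * (h * (x - d)) = S * m - S * g.
  by rewrite -mulrDr m2 mulrBr.
move=> key hC0.
have q c : c <= C0 - ln 4 -> expR c <= expR C0 / 4.
  by move=> hc; rewrite -[4]lnK ?posrE// -expRN -expRD ler_expR.
have q1 := q (C1 - S * (h * (x + d))); have q2 := q (C2 + S * (h * (x - d))).
have {q1 q2} : expR C0 / 2 <= expR (S * (2 * m + td)) * L.
  have : expR (C1 - S * (h * (x + d))) <= expR C0 / 4 by apply: q1; lra.
  have : expR (C2 + S * (h * (x - d))) <= expR C0 / 4 by apply: q2; lra.
  lra.
rewrite -ler_pdivrMl ?expR_gt0// -expRN => /(le_trans _); apply.
rewrite -[2^-1]lnK ?posrE ?invr_gt0// lnV ?posrE// -!expRD ler_expR.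
have : ln 2 <= ln 4 :> R by rewrite ler_ln ?posrE// ler_nat.
lra.
Qed.

Lemma law_lower (A : set R) (x y : R) : A° x -> x ^+ 2 / (2 * v) < y ->
  \forall n \near \oo, expR (- (s n * y)) <= law n A.
Proof.
move=> Ax xy.
have vn0 : v != 0 by rewrite gt_eqF.
pose t := x / v.
have [e e0 ye] : exists2 e, 0 < e & y = x ^+ 2 / (2 * v) + 4 * e.
  by exists ((y - x ^+ 2 / (2 * v)) / 4); [lra|field].
have [d [d0 dA dt]] : exists d : R,
    [/\ 0 < d, forall z, `|z - x| < d -> A z & `|t| * d <= e].
  have [d0 /= d00 hd] := (nbhs_ballP x A).1 Ax.
  (* The window stays inside [A], and the cost [|t| d] of moving within it stays below [e]; the
     [+ 1] covers [t = 0]. *)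
  exists (Num.min d0 (e / (`|t| + 1))); split.
  - by rewrite lt_min d00 divr_gt0// ltr_pwDr.
  - move=> z; rewrite lt_min => /andP[zd _]; apply: hd.
    by rewrite /ball/= distrC.
  rewrite (@le_trans _ _ (`|t| * (e / (`|t| + 1))))// ?ler_wpM2l ?ge_min ?lexx ?orbT//.
  by rewrite mulrA ler_pdivrMr ?ltr_pwDr// mulrC ler_pM2l// lerDl.
pose h := d / v; pose f := Num.min e (d ^+ 2 / (2 * v) / 4).
have h0 : 0 < h by rewrite divr_gt0.
have f0 : 0 < f by rewrite lt_min e0 !divr_gt0// ?exprn_gt0// mulr_gt0.
have fe : f <= e by rewrite ge_min lexx.
have fd : 4 * f <= d ^+ 2 / (2 * v).
  by rewrite mulrC -ler_pdivlMr// ge_min lexx orbT.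
have c0 := cgf_near t f0; have c1 := cgf_near (t + h) f0.
have c2 := cgf_near (t - h) f0.
near=> n.
have s0 : 0 < s n by near: n; exact: speed_gt.
have sf : ln 4 <= s n * f.
  by rewrite -ler_pdivrMr//; apply: ltW; near: n; exact: speed_gt.
have b0 : s n * (v * t ^+ 2 / 2 - f) <= C n t <= s n * (v * t ^+ 2 / 2 + f).
  by near: n.
have b1 : s n * (v * (t + h) ^+ 2 / 2 - f) <= C n (t + h) <=
    s n * (v * (t + h) ^+ 2 / 2 + f) by near: n.
have b2 : s n * (v * (t - h) ^+ 2 / 2 - f) <= C n (t - h) <=
    s n * (v * (t - h) ^+ 2 / 2 + f) by near: n.
have key := @tilted_law_ge n A x d t h (ltW s0) (ltW h0) dA.
rewrite ye; move: b0 b1 b2 => /andP[b0 _] /andP[_ b1] /andP[_ b2].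
exact: lower_expR s0 vn0 sf fe fd dt b0 b1 b2 key.
Unshelve. all: by end_near. Qed.

Let scaled_lne_le (S L c : R) : 0 < S -> L <= expR (S * c) ->
  ((S^-1)%:E * lne L%:E <= c%:E)%E.
Proof.
move=> S0 Lc; have [L0|L0] := leP L 0.
  by rewrite le0_lneNy// gt0_muleNy ?leNye// lte_fin invr_gt0.
rewrite lne_EFin// -EFinM lee_fin ler_pdivrMl//.
by rewrite -ler_expR lnK ?posrE.
Qed.

Let scaled_lne_ge (S L c : R) : 0 < S -> expR (S * c) <= L ->
  (c%:E <= (S^-1)%:E * lne L%:E)%E.
Proof.
move=> S0 Lc; have L0 : 0 < L by exact: lt_le_trans (expR_gt0 _) Lc.
rewrite lne_EFin// -EFinM lee_fin ler_pdivlMl//.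
by rewrite -ler_expR lnK ?posrE.
Qed.

Lemma gaussian_LDP (mu : nat -> probability R R) :
  (forall n A, measurable A -> mu n A = (law n A)%:E) ->
  LDP mu s (fun x => (x ^+ 2 / (2 * v))%:E).
Proof.
move=> muE; have v2 : 0 < 2 * v by rewrite mulr_gt0.
split; first exact: s_oo.
  split=> [x|a a0]; first by rewrite lee_fin divr_ge0 ?sqr_ge0 ?ltW.
  rewrite (_ : [set x | _] =
    `[- Num.sqrt (2 * v * a), Num.sqrt (2 * v * a)]%classic).
    exact: segment_compact.
  apply/seteqP; split => x /=; rewrite lee_fin in_itv/= -ler_norml ler_pdivrMr//.
    by rewrite mulrC -ler_sqrt ?sqrtr_sqr// mulr_ge0// ltW.
  by rewrite mulrC -(@ler_sqrt _ (x ^+ 2)) ?sqrtr_sqr// mulr_ge0// ltW.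
move=> A mA; split; last 2 first.
- exact: limn_einf_sup.
- apply: limn_esup_le_real => y; rewrite lteNl; set m := ereal_inf _ => ym.
  (* For [y >= 0] the bound only says that a probability is at most 1. *)
  have [y0|y0] := leP 0 y.
    near=> n; have s0 : 0 < s n by near: n; exact: speed_gt.
    rewrite muE//; apply: scaled_lne_le => //; apply: le_trans (law_le1 n A) _.
    by rewrite -[leLHS]expR0 ler_expR mulr_ge0// ltW.
  (* [m] is infinite when the closure of [A] is empty; any real above [- y] then serves. *)
  have [y' yy' y'm] : exists2 y' : R, - y < y' & (y'%:E <= m)%E.
    move: ym; case: (m) => [z| |]// h; last by exists (- y + 1);
      [rewrite ltrDl|exact: leey].
    by exists z; [rewrite -lte_fin|].
  have hA x : A x -> y' <= x ^+ 2 / (2 * v).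
    move=> Ax; rewrite -lee_fin (le_trans y'm)//; apply: ereal_inf_lbound.
    by exists x => //; exact: subset_closure.
  have y'0 : 0 < y' by lra.
  have h := law_upper y'0 yy' hA.
  near=> n; have s0 : 0 < s n by near: n; exact: speed_gt.
  rewrite muE//; apply: scaled_lne_le => //; rewrite -[y]opprK mulrN.
  by near: n.
- rewrite leeNl; apply: le_ereal_inf_tmp => _ [x Ax <-]; rewrite leeNl.
  apply: limn_einf_ge_real => y; rewrite lte_fin => xy.
  have h := law_lower Ax xy.
  near=> n; have s0 : 0 < s n by near: n; exact: speed_gt.
  rewrite muE// -EFinN; apply: scaled_lne_ge => //; rewrite mulrN.
  by near: n.
Unshelve. all: by end_near. Qed.

End GaussianLDP.

(** * Counts of members of a regular family of sets *)

Section FamilyAsymptotics.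
Context {R : realType}.

(** The error must carry the factor [p (1 - p)], to stay small relative to the variance when [p]
    approaches 0 or 1. First-order terms cancel in the mean, and [x - x^2 <= ln (1 + x) <= x] for
    [x >= 0] passes to the logarithm. *)
Lemma ln_bernoulli_mgf (p u : R) : 0 <= p <= 1 -> `|u| <= 1 / 4 ->
  `|ln (p * expR (u * (1 - p)) + (1 - p) * expR (u * (0 - p))) -
    p * (1 - p) * u ^+ 2 / 2| <= 4 * (p * (1 - p)) * `|u| ^+ 3.
Proof.
move=> /andP[p0 p1]; set a := `|u| => u4; set q := p * (1 - p).
have a0 : 0 <= a by exact: normr_ge0.
have q0 : 0 <= q by rewrite mulr_ge0// subr_ge0.
have q4 : q <= 1 / 4 by rewrite /q; have := sqr_ge0 (p - 1 / 2); nra.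
have ua : u ^+ 2 = a ^+ 2 by rewrite real_normK ?num_real.
(* Only two of the three factors [1 - p] are kept, so that the two weighted errors add up to
   [2 a^3 p (1 - p)]. *)
have t1 : `|expR (u * (1 - p)) - (1 + u * (1 - p) + (u * (1 - p)) ^+ 2 / 2)| <=
  2 * a ^+ 3 * (1 - p) ^+ 2.
  apply: le_trans (expR_taylor2 _) _;
    rewrite normrM (@ger0_norm _ (1 - p)) ?subr_ge0//.
    by rewrite -/a; nra.
  rewrite exprMn -mulrA ler_wpM2l// ler_wpM2l ?exprn_ge0//.
  by apply: ler_wiXn2l; rewrite ?subr_ge0 ?gerBl.
have t2 : `|expR (u * (0 - p)) - (1 + u * (0 - p) + (u * (0 - p)) ^+ 2 / 2)| <=
  2 * a ^+ 3 * p ^+ 2.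
  apply: le_trans (expR_taylor2 _) _;
    rewrite normrM sub0r normrN (@ger0_norm _ p)//.
    by rewrite -/a; nra.
  by rewrite exprMn -mulrA ler_wpM2l// ler_wpM2l ?exprn_ge0//; apply: ler_wiXn2l.
move: t1 t2; rewrite !ler_norml; set E1 := expR _;
  set E2 := expR _ => /andP[l1 h1] /andP[l2 h2].
set m := p * E1 + (1 - p) * E2.
have m_gt0 : 0 < m.
  have e1 : 0 < E1 by exact: expR_gt0.
  have e2 : 0 < E2 by exact: expR_gt0.
  rewrite /m; have [->|pn0] := eqVneq p 0; first by rewrite mul0r add0r subr0 mul1r.
  have : 0 < p * E1 by rewrite mulr_gt0// lt_neqAle eq_sym pn0.
  have : 0 <= (1 - p) * E2 by rewrite mulr_ge0 ?subr_ge0// ltW.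
  lra.
have a2 : 0 <= a ^+ 2 by exact: sqr_ge0.
have a3 : a ^+ 3 = a * a ^+ 2 by rewrite exprS.
have ml : q * a ^+ 2 / 2 - 2 * q * a ^+ 3 <= m - 1.
  have := ler_wpM2l p0 l1; have := @ler_wpM2l _ (1 - p) _ _ _ l2.
  rewrite subr_ge0 => /(_ p1); rewrite !exprMn ua /m /q; lra.
have mh : m - 1 <= q * a ^+ 2 / 2 + 2 * q * a ^+ 3.
  have := ler_wpM2l p0 h1; have := @ler_wpM2l _ (1 - p) _ _ _ h2.
  rewrite subr_ge0 => /(_ p1); rewrite !exprMn ua /m /q; lra.
have qa0 : 0 <= q * a ^+ 2 by rewrite mulr_ge0.
have qa1 : 0 <= q * a ^+ 2 * (1 / 4 - a) by rewrite mulr_ge0// subr_ge0.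
have x0 : 0 <= m - 1 by apply: le_trans ml; rewrite a3; lra.
have x1 : m - 1 <= q * a ^+ 2 by apply: le_trans mh _; rewrite a3; lra.
have ln_le (x : R) : 0 < x -> ln x <= x - 1.
  move=> xp; have -> : ln x = ln (1 + (x - 1)) by congr ln; ring.
  by rewrite le_ln1Dx//; lra.
have lh := ln_le _ m_gt0.
(* This is [ln m >= 1 - m^-1] together with [m^-1 <= 1 - x + x^2], valid because [x = m - 1] is
   nonnegative. *)
have ll : m - 1 - (m - 1) ^+ 2 <= ln m.
  have : ln m^-1 <= m^-1 - 1 by rewrite ln_le// invr_gt0.
  rewrite lnV ?posrE//; set x := m - 1.
  have mv : m * m^-1 = 1 by rewrite mulfV// gt_eqF.
  have : m^-1 <= 1 - x + x ^+ 2.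
    rewrite -div1r ler_pdivrMr// /x.
    have : 0 <= (m - 1) ^+ 3 by rewrite exprn_ge0.
    by nra.
  lra.
have xx : (m - 1) ^+ 2 <= q * a ^+ 3.
  apply: (@le_trans _ _ ((q * a ^+ 2) ^+ 2));
    first by rewrite lerXn2r ?nnegrE// mulr_ge0.
  have -> : (q * a ^+ 2) ^+ 2 = q * a ^+ 3 * (q * a) by ring.
  rewrite ler_piMr ?mulr_ge0 ?exprn_ge0//; nra.
rewrite ua; apply/andP; split; have := mulr_ge0 q0 (exprn_ge0 3 a0); lra.
Qed.

Lemma Ex_expR_linear_part (I : finType) (p u : R) :
  Ex p (fun w : {ffun I -> bool} => expR (u * linear_part p w)) =
  (p * expR (u * (1 - p)) + (1 - p) * expR (u * (0 - p))) ^+ #|I|.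
Proof.
rewrite -[RHS]prodr_const -(@Ex_prod R I p (fun _ b => expR (u * (b%:R - p)))).
by apply: Ex_ext => w; rewrite /linear_part mulr_sumr expR_sum.
Qed.

Context (I J : nat -> finType) (K : forall n, J n -> {set I n}).
Context (k : nat) (D D2 : nat -> nat) (p s tau : nat -> R) (v : R).
Hypothesis p01 : forall n, 0 < p n < 1.
Hypothesis k_gt0 : (0 < k)%N.
Hypothesis card_K : forall n j, #|@K n j| = k.
Hypothesis degree_K : forall n (i : I n), #|[set j | i \in @K n j]%SET| = D n.
Hypothesis codegree_K : forall n (i m : I n), i != m ->
  (#|[set j | (i \in @K n j) && (m \in @K n j)]%SET| <= D2 n)%N.
Hypothesis s_oo : s n @[n --> \oo] --> +oo.
Hypothesis v_gt0 : 0 < v.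

(** The variance of [p^(k-1) (X_i - p)]. With it, [tau_eq] says that [tau] times the linear term has
    variance [v s], which after division by [s] gives the limit [v t^2 / 2]. *)
Let q2 n := p n ^+ (2 * k).-1 * (1 - p n).
Let N n : R := #|I n|%:R.

Hypothesis D_gt0 : \forall n \near \oo, (0 < D n)%N.
Hypothesis N_gt0 : \forall n \near \oo, (0 < #|I n|)%N.
Hypothesis tau_eq : \forall n \near \oo,
  (tau n * (D n)%:R) ^+ 2 * (N n * q2 n) = v * s n.
Hypothesis codegree_small : (D2 n)%:R / ((D n)%:R * q2 n) @[n --> \oo] --> 0.
Hypothesis speed_small : s n / (N n * q2 n ^+ 2) @[n --> \oo] --> 0.

Let p01' n : 0 <= p n <= 1. Proof. by case/andP: (p01 n) => *; rewrite !ltW. Qed.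

Let q2_gt0 n : 0 < q2 n.
Proof. by case/andP: (p01 n) => p0 p1; rewrite mulr_gt0 ?exprn_gt0 ?subr_gt0. Qed.

Let q2_le1 n : q2 n <= 1.
Proof.
case/andP: (p01' n) => p0 p1; rewrite mulr_ile1 ?exprn_ge0 ?exprn_ile1 ?subr_ge0//.
by rewrite gerBl.
Qed.

(** [tau D] bounds, up to sign, the effect of one coordinate on [tau] times the remainder; its
    smallness puts [t tau] in the range of the exponential inequalities. *)
Let tauD_small e : 0 < e -> \forall n \near \oo, (tau n * (D n)%:R) ^+ 2 <= e.
Proof.
move=> e0; near=> n.
have Nn : 0 < N n by rewrite ltr0n; near: n.
have s0 : 0 < s n by near: n; exact: speed_gt.
have te : (tau n * (D n)%:R) ^+ 2 * (N n * q2 n) = v * s n by near: n.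
have b : s n / (N n * q2 n ^+ 2) <= e / v.
  by near: n; apply: (cvgr_le _ speed_small); rewrite divr_gt0.
have -> : (tau n * (D n)%:R) ^+ 2 = v * (s n / (N n * q2 n ^+ 2)) * q2 n.
  have nq : N n * q2 n != 0 by rewrite mulf_neq0 ?gt_eqF.
  apply: (mulIf nq); rewrite te; field.
  by rewrite !gt_eqF.
apply: (@le_trans _ _ (v * (s n / (N n * q2 n ^+ 2)))).
  rewrite ler_piMr// mulr_ge0 ?(ltW v_gt0)// divr_ge0 ?(ltW s0)//.
  by rewrite mulr_ge0 ?sqr_ge0 ?(ltW Nn).
by rewrite mulrC -ler_pdivlMr.
Unshelve. all: by end_near. Qed.

Let cgf_remainder t e : 0 < e -> \forall n \near \oo,
  (s n)^-1 * cgf (@weight R (I n) (p n))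
    (fun w => t * (tau n * remainder (@K n) k (p n) w)) <= e.
Proof.
move=> e0.
have small (c : R) (u : nat -> R) : 0 <= c -> u n @[n --> \oo] --> 0 ->
    \forall n \near \oo, c * u n <= e / 2.
  move=> c0 u0; near=> n.
  have : u n <= e / 2 / (c + 1).
    by near: n; apply: (cvgr_le _ u0); rewrite !divr_gt0// ltr_wpDl.
  rewrite ler_pdivlMr ?ltr_wpDl// => h.
  have [un|un] := leP 0 (u n); first by apply: le_trans h;
    rewrite mulrDr mulr1 mulrC lerDl.
  by rewrite (@le_trans _ _ 0) ?divr_ge0 ?(ltW e0)// mulr_ge0_le0// ltW.
(* Substituting [(tau D)^2 N = v s / q2] turns the two terms of [Ex_expR_remainder_le] into
   [s c1 D2 / (D q2)] and [s c2 s / (N q2^2)]. *)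
pose c1 := 4 * k%:R * t ^+ 2 * v; pose c2 := 64 * k%:R ^+ 2 * t ^+ 4 * v ^+ 2.
have c10 : 0 <= c1 by rewrite mulr_ge0 ?(ltW v_gt0)// mulr_ge0 ?sqr_ge0// mulr_ge0.
have c20 : 0 <= c2.
  by rewrite mulr_ge0 ?sqr_ge0// mulr_ge0 ?exprn_even_ge0// mulr_ge0// sqr_ge0.
have h1 := small _ _ c10 codegree_small; have h2 := small _ _ c20 speed_small.
have tk0 : 0 < t ^+ 2 * k%:R + 1 by rewrite ltr_wpDl// mulr_ge0 ?sqr_ge0.
near=> n.
have Nn : 0 < N n by rewrite ltr0n; near: n.
have Dn : 0 < (D n)%:R :> R by rewrite ltr0n; near: n.
have s0 : 0 < s n by near: n; exact: speed_gt.
have te : (tau n * (D n)%:R) ^+ 2 * (N n * q2 n) = v * s n by near: n.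
have b1 : c1 * ((D2 n)%:R / ((D n)%:R * q2 n)) <= e / 2 by near: n.
have b2 : c2 * (s n / (N n * q2 n ^+ 2)) <= e / 2 by near: n.
have b3 : (tau n * (D n)%:R) ^+ 2 <= 1 / 16 / (t ^+ 2 * k%:R + 1).
  by near: n; apply: tauD_small; rewrite !divr_gt0.
have b4 : (t * tau n * (D n)%:R) ^+ 2 * k%:R <= 1 / 16.
  move: b3; rewrite ler_pdivlMr//; have := sqr_ge0 (tau n * (D n)%:R).
  by rewrite !exprMn; lra.
have b5 : `|t * tau n| * (D n)%:R <= 1 / 4.
  rewrite -[(D n)%:R]normr_nat -normrM -ler_sqr ?nnegrE// real_normK ?num_real//.
  apply: (@le_trans _ _ ((t * tau n * (D n)%:R) ^+ 2 * k%:R)); last lra.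
  by rewrite ler_peMr ?sqr_ge0// ler1n.
have cE := @Ex_expR_remainder_le R (I n) (J n) (@K n) k (D n) (D2 n) (p n) (p01' n)
  (@card_K n) (@degree_K n) (@codegree_K n) _ b5 b4.
rewrite (@cgf_ext _ _ _ _ (fun w => t * tau n * remainder (@K n) k (p n) w));
  last first.
  by move=> w; rewrite mulrA.
have wsum := sum_weight (I n) (p n).
have := cgf_le (weight_ge0 (p01' n)) wsum cE.
rewrite ler_pdivrMl// => /le_trans; apply.
have q0 : q2 n != 0 by rewrite gt_eqF.
have s1 : v * s n / q2 n = (tau n * (D n)%:R) ^+ 2 * N n.
  by rewrite -te mulrA mulfK.
apply: (@le_trans _ _ (s n * (c1 * ((D2 n)%:R / ((D n)%:R * q2 n)) +
    c2 * (s n / (N n * q2 n ^+ 2))))); last first.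
  by rewrite ler_pM2l// [e]splitr lerD.
rewrite le_eqVlt; apply/orP; left; apply/eqP; rewrite mulrDr; congr (_ + _).
  rewrite /c1 [RHS](_ : _ =
    4 * k%:R * t ^+ 2 * (v * s n / q2 n) * ((D2 n)%:R / (D n)%:R)).
    by rewrite s1 -/(N n); field; rewrite gt_eqF.
  by field; rewrite q0 gt_eqF.
rewrite /c2 [RHS](_ : _ = 64 * k%:R ^+ 2 * t ^+ 4 * (v * s n / q2 n) ^+ 2 / N n).
  by rewrite s1 -/(N n); field; rewrite gt_eqF.
by field; rewrite q0 gt_eqF.
Unshelve. all: by end_near. Qed.

Let cgf_linear t :
  (s n)^-1 * cgf (@weight R (I n) (p n))
    (fun w => t * (tau n * ((D n)%:R * p n ^+ k.-1 * linear_part (p n) w)))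
  @[n --> \oo] --> v * t ^+ 2 / 2.
Proof.
apply/cvgrPdist_le => e e0.
have tv0 : 0 < 4 * t ^+ 2 * v + 1.
  by rewrite ltr_wpDl// mulr_ge0 ?(ltW v_gt0)// mulr_ge0 ?sqr_ge0.
(* The first entry admits [ln_bernoulli_mgf]; the second makes its cubic error, [4 t^2 v |u|] after
   division by [s], at most [e]. *)
pose d := Num.min (1 / 4) (e / (4 * t ^+ 2 * v + 1)).
have d0 : 0 < d by rewrite lt_min !divr_gt0.
have t20 : 0 < t ^+ 2 + 1 by rewrite ltr_wpDl ?sqr_ge0.
near=> n.
have s0 : 0 < s n by near: n; exact: speed_gt.
have te : (tau n * (D n)%:R) ^+ 2 * (N n * q2 n) = v * s n by near: n.
have b3 : (tau n * (D n)%:R) ^+ 2 <= d ^+ 2 / (t ^+ 2 + 1).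
  by near: n; apply: tauD_small; rewrite divr_gt0// exprn_gt0.
pose u := t * tau n * (D n)%:R * p n ^+ k.-1.
have ud : `|u| <= d.
  rewrite -ler_sqr ?nnegrE ?(ltW d0)// real_normK ?num_real//.
  have : (tau n * (D n)%:R) ^+ 2 * (t ^+ 2 + 1) <= d ^+ 2 by rewrite -ler_pdivlMr.
  apply: le_trans; rewrite /u.
  apply: (@le_trans _ _ ((tau n * (D n)%:R) ^+ 2 * t ^+ 2)).
    rewrite [leLHS](_ : _ =
      (tau n * (D n)%:R) ^+ 2 * t ^+ 2 * (p n ^+ k.-1) ^+ 2); last by ring.
    case/andP: (p01' n) => p0 p1.
    by rewrite ler_piMr ?exprn_ile1 ?exprn_ge0// mulr_ge0 ?sqr_ge0.
  by rewrite ler_wpM2l ?sqr_ge0// lerDl.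
have u4 : `|u| <= 1 / 4 by rewrite (le_trans ud)// ge_min lexx.
have ue : 4 * t ^+ 2 * v * `|u| <= e.
  have : `|u| <=
    e / (4 * t ^+ 2 * v + 1) by rewrite (le_trans ud)// ge_min lexx orbT.
  by rewrite ler_pdivlMr//; have := normr_ge0 u; lra.
have -> : cgf (@weight R (I n) (p n))
    (fun w => t * (tau n * ((D n)%:R * p n ^+ k.-1 * linear_part (p n) w))) =
    N n * ln (p n * expR (u * (1 - p n)) + (1 - p n) * expR (u * (0 - p n))).
  rewrite (@cgf_ext _ _ _ _ (fun w => u * linear_part (p n) w)); last first.
    by move=> w; rewrite /u !mulrA.
  rewrite /cgf -/(Ex _ _) Ex_expR_linear_part lnXn ?mulr_natl//.
  case/andP: (p01 n) => p0 p1.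
  by rewrite addr_gt0// mulr_gt0 ?expR_gt0// subr_gt0.
have := ln_bernoulli_mgf (p01' n) u4; set L := ln _ => hL.
have Nu : N n * (p n * (1 - p n)) * u ^+ 2 = t ^+ 2 * v * s n.
  rewrite -[RHS]mulrA -te /u /q2.
  have -> : (2 * k).-1 = (k.-1 + k.-1).+1 by lia.
  by rewrite [p n ^+ (_ + _).+1]exprS exprD; ring.
have -> : v * t ^+ 2 / 2 - (s n)^-1 * (N n * L) =
    - ((s n)^-1 * N n) * (L - p n * (1 - p n) * u ^+ 2 / 2).
  have -> : v * t ^+ 2 / 2 = (s n)^-1 * (t ^+ 2 * v * s n) / 2.
    by field; rewrite gt_eqF.
  by rewrite -Nu; ring.
rewrite normrM normrN (@ger0_norm _ (_^-1 * _)) ?mulr_ge0 ?invr_ge0 ?(ltW s0)//.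
apply: (@le_trans _ _ ((s n)^-1 * N n * (4 * (p n * (1 - p n)) * `|u| ^+ 3))).
  by rewrite ler_wpM2l// mulr_ge0 ?invr_ge0 ?(ltW s0).
apply: le_trans ue; rewrite exprS real_normK ?num_real//.
have -> : (s n)^-1 * N n * (4 * (p n * (1 - p n)) * (`|u| * u ^+ 2)) =
   (s n)^-1 * 4 * `|u| * (N n * (p n * (1 - p n)) * u ^+ 2) by ring.
by rewrite Nu le_eqVlt; apply/orP; left; apply/eqP; field; rewrite gt_eqF.
Unshelve. all: by end_near. Qed.

Lemma cgf_family_count t :
  (s n)^-1 * cgf (@weight R (I n) (p n))
    (fun w => t * (tau n * family_count (@K n) k (p n) w))
  @[n --> \oo] --> v * t ^+ 2 / 2.
Proof.
have := @cgf_add_cvg R (fun n => {ffun I n -> bool}) (fun n =>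
  @weight R (I n) (p n))
  (fun n => weight_ge0 (p01' n)) (fun n => sum_weight _ (p n)) s s_oo
  (fun n w => tau n * ((D n)%:R * p n ^+ k.-1 * linear_part (p n) w))
  (fun n w => tau n * remainder (@K n) k (p n) w) v (ltW v_gt0) cgf_linear cgf_remainder t.
apply: cvg_trans; apply: near_eq_cvg; near=> n; congr (_ * _).
apply: cgf_ext => w; congr (_ * _).
by rewrite (family_count_decomp k (p n) (@degree_K n)) mulrDr.
Unshelve. all: by end_near. Qed.

End FamilyAsymptotics.

(** * Embeddings of a graph in a complete graph *)

Section Embeddings.
Variables (G : simple_graph) (W : finType).
Implicit Types (f : {ffun G -> W}) (x y : G).

Definition embedding := {f : {ffun G -> W} | injectiveb f}.

Definition image_edges f : {set {set W}} :=
  [set [set f x | x in A] | A : {set G} in edges G]%SET.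

Lemma card_embedding : #|{: embedding}| = (#|W| ^_ #|G|)%N.
Proof. by rewrite card_sig -card_inj_ffuns; apply: eq_card => f; rewrite inE. Qed.

Lemma embedding_inj (f : embedding) : injective (val f).
Proof. exact/injectiveP/(valP f). Qed.

Lemma adj_neq x y : adj x y -> x != y.
Proof. by apply: contraTN => /eqP ->; rewrite adj_irr. Qed.

Lemma mem_edges x y : ([set x; y]%SET \in edges G) = adj x y.
Proof.
apply/imsetP/idP => [[[u v] /= uv xy]|xy]; last by exists (x, y).
move: uv; rewrite inE /= => uv; have uv' := adj_neq uv.
have : x \in [set u; v]%SET by rewrite -xy !inE eqxx.
have : y \in [set u; v]%SET by rewrite -xy !inE eqxx orbT.
have : v \in [set x; y]%SET by rewrite xy !inE eqxx orbT.
have : u \in [set x; y]%SET by rewrite xy !inE eqxx.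
rewrite !inE => hu hv /orP[]/eqP yE /orP[]/eqP xE; move: hu hv; rewrite xE yE //.
- by rewrite !orbb [v == u]eq_sym (negbTE uv').
- by rewrite adj_sym.
- by rewrite !orbb (negbTE uv').
Qed.

Lemma edgesP (A : {set G}) :
  reflect (exists x y, A = [set x; y]%SET /\ adj x y) (A \in edges G).
Proof.
apply: (iffP imsetP) => [[[x y] /= xy ->]|[x [y [-> xy]]]]; last by exists (x, y).
by exists x, y.
Qed.

Lemma imset_pair f x y :
  [set f z | z in [set x; y]]%SET = [set f x; f y]%SET.
Proof. by rewrite finset.imsetU !finset.imset_set1. Qed.

Lemma image_edgesP f (B : {set W}) :
  reflect (exists x y, B = [set f x; f y]%SET /\ adj x y) (B \in image_edges f).
Proof.
apply: (iffP imsetP) => [[A /edgesP[x [y [-> xy]]] ->]|[x [y [-> xy]]]].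
  by exists x, y; rewrite imset_pair.
by exists [set x; y]%SET; rewrite ?mem_edges ?imset_pair.
Qed.

Lemma mem_image_edges f x y : injective f ->
  ([set f x; f y]%SET \in image_edges f) = adj x y.
Proof.
move=> fi; rewrite -mem_edges -imset_pair (mem_imset (edges G))//.
exact: imset_inj.
Qed.

Lemma card_image_edges f : injective f -> #|image_edges f| = #|edges G|.
Proof. by move=> fi; rewrite card_imset//; exact: imset_inj. Qed.

Lemma card_image_edge f B : injective f -> B \in image_edges f -> #|B| = 2%N.
Proof.
move=> fi /image_edgesP[x [y [-> /adj_neq xy]]].
by rewrite cards2 (inj_eq fi) xy.
Qed.

Hypothesis G_noiso : no_isolated_vertex G.

Lemma mem_cover_image_edges f w :
  (w \in finset.cover (image_edges f)) = (w \in codom f).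
Proof.
apply/bigcupP/codomP => [[B /image_edgesP[x [y [-> xy]]]]|[x ->]].
  by rewrite !inE => /orP[]/eqP ->; [exists x|exists y].
have [y xy] := G_noiso x; exists [set f x; f y]%SET; last by rewrite !inE eqxx.
by apply/image_edgesP; exists x, y.
Qed.

Lemma image_edges_iso f (F : {set {set W}}) : injective f -> image_edges f = F ->
  graph_iso (edge_subgraph F) G.
Proof.
move=> fi <- {F}; set F := image_edges f.
have fc x : f x \in finset.cover F by rewrite mem_cover_image_edges codom_f.
pose psi x : edge_subgraph F := Sub (f x) (fc x).
have psi_inj : injective psi by move=> x y /(congr1 val) /= /fi.
have psi_surj (v : edge_subgraph F) : exists x, psi x == v.
  have : val v \in codom f by rewrite -mem_cover_image_edges (valP v).
  by move=> /codomP[x vx]; exists x; apply/eqP/val_inj.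
have psi_bij : bijective psi.
  apply: (@Bijective _ _ psi (fun v => xchoose (psi_surj v))) => [x|v].
    by apply: psi_inj; exact/eqP/(xchooseP (psi_surj (psi x))).
  exact/eqP/(xchooseP (psi_surj v)).
have [phi phiK psiK] := psi_bij.
exists phi; split; first by exists psi.
move=> u v; rewrite -{2}(psiK u) -{2}(psiK v) /= /edge_subgraph_adj /=.
rewrite mem_image_edges// andbC; case xy: (adj _ _) => //=.
by rewrite (inj_eq psi_inj) (adj_neq xy).
Qed.

(** The inverse isomorphism, read in [W], is the injection. Members of [F] must be pairs, since
    adjacency in [edge_subgraph] sees no other sets. *)
Lemma iso_image_edges (F : {set {set W}}) : (forall B, B \in F -> #|B| = 2%N) ->
  graph_iso (edge_subgraph F) G ->
  exists f, injective f /\ image_edges f = F.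
Proof.
move=> F2 [phi [[psi phiK psiK] phi_adj]].
pose f : {ffun G -> W} := [ffun x => val (psi x)].
have fi : injective f.
  by move=> x y; rewrite !ffunE => /val_inj /(can_inj psiK).
exists f; split => //; apply/setP => B; apply/image_edgesP/idP.
  move=> [x [y [-> xy]]]; rewrite !ffunE.
  by move: xy; rewrite -(psiK x) -(psiK y) phi_adj !phiK /= => /andP[].
move=> BF; have /eqP/cards2P[u [v [uv BE]]] := F2 _ BF.
have uF : u \in finset.cover F by apply/bigcupP; exists B; rewrite // BE !inE eqxx.
have vF : v \in finset.cover F by apply/bigcupP; exists B;
  rewrite // BE !inE eqxx orbT.
pose u' : edge_subgraph F := Sub u uF; pose v' : edge_subgraph F := Sub v vF.
exists (phi u'), (phi v'); rewrite !ffunE !phiK phi_adj; split => //=.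
rewrite /edge_subgraph_adj /= -BE BF andbT.
by apply: contra uv => /eqP/(congr1 val) /= ->.
Qed.

(** Automorphisms act by precomposition, freely and transitively on the injections with given image
    edges. *)
Lemma card_same_image_edges f0 : injective f0 ->
  #|[set f : embedding | image_edges (val f) == image_edges f0]%SET| = aut_order G.
Proof.
move=> f0i.
have comp_inj (s : {perm G}) : injectiveb [ffun x => f0 (s x)].
  by apply/injectiveP => x y; rewrite !ffunE => /f0i/perm_inj.
pose h (s : {perm G}) : embedding :=
  exist (fun f : {ffun G -> W} => injectiveb f) _ (comp_inj s).
have h_inj : injective h.
  move=> s t /(congr1 val)/ffunP st; apply/permP => x; apply: f0i.
  by have := st x; rewrite /= !ffunE.
rewrite /aut_order -(card_imset _ h_inj); apply: eq_card => f; rewrite inE.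
apply/eqP/imsetP => [fE|[s]]; last first.
  rewrite inE => /forallP sa ->; have {}sa x y : adj (s x) (s y) = adj x y.
    by apply/eqP; move/forallP: (sa x).
  apply/setP => B; apply/image_edgesP/image_edgesP => -[x [y [-> xy]]].
    by exists (s x), (s y); rewrite /= !ffunE sa.
  exists (s^-1 x)%g, (s^-1 y)%g; rewrite /= !ffunE !permKV; split => //.
  by rewrite -sa !permKV.
have fi := @embedding_inj f.
(* Equal image edges cover equal vertex sets, so [f0^-1 f] is defined on all of [G]. *)
have ex x : exists y, f0 y == val f x.
  have : val f x \in codom f0.
    by rewrite -mem_cover_image_edges -fE mem_cover_image_edges codom_f.
  by move=> /codomP[y ->]; exists y.
pose s x := xchoose (ex x).
have sE x : f0 (s x) = val f x by apply/eqP; exact: (xchooseP (ex x)).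
have s_inj : injective s by move=> x y sxy; apply: fi; rewrite -!sE sxy.
exists (perm s_inj).
  rewrite inE; apply/forallP => x; apply/forallP => y; rewrite !permE.
  by rewrite -(mem_image_edges _ _ f0i) !sE -fE mem_image_edges.
by apply: val_inj; apply/ffunP => x /=; rewrite ffunE permE sE.
Qed.

Lemma card_embedding_onto (F : {set {set W}}) :
  (forall B, B \in F -> #|B| = 2%N) ->
  #|[set f : embedding | image_edges (val f) == F]%SET| =
  (`[< graph_iso (edge_subgraph F) G >] * aut_order G)%N.
Proof.
move=> F2; case: asboolP => [/(iso_image_edges F2)[f [fi <-]]|nF].
  by rewrite mul1n card_same_image_edges.
rewrite mul0n; apply: eq_card0 => f; rewrite inE; apply/negP => /eqP fF.
by apply: nF; apply: image_edges_iso fF; exact: embedding_inj.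
Qed.

End Embeddings.

(** * Degrees and codegrees of the family of embedded edge sets *)

Section EmbeddingCounts.
Variables (G : simple_graph) (W I : finType) (e : I -> {set W}).
Hypothesis e_inj : injective e.
Hypothesis e_pairs : [set e i | i : I]%SET = [set A : {set W} | #|A| == 2%N]%SET.
Implicit Types (f : embedding G W) (i m : I).

Definition edge_indices f : {set I} := [set i | e i \in image_edges (val f)]%SET.

Lemma card_edge_set i : #|e i| = 2%N.
Proof.
have : e i \in [set e i | i : I]%SET by rewrite imset_f.
by rewrite e_pairs inE => /eqP.
Qed.

Lemma imset_edge_indices f : [set e i | i in edge_indices f]%SET =
  image_edges (val f).
Proof.
apply/setP => B; apply/imsetP/idP => [[i]|BF]; first by rewrite inE => ? ->.
have : B \in [set e i | i : I]%SET.
  by rewrite e_pairs inE (card_image_edge (@embedding_inj _ _ f) BF).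
by move=> /imsetP[i _ BE]; exists i => //; rewrite inE -BE.
Qed.

Lemma card_edge_indices f : #|edge_indices f| = #|edges G|.
Proof.
by rewrite -(card_imset _ e_inj) imset_edge_indices card_image_edges//;
  exact: embedding_inj.
Qed.

Lemma edge_indices_eq f (K : {set I}) :
  (edge_indices f == K) = (image_edges (val f) == [set e i | i in K]%SET).
Proof. by rewrite -imset_edge_indices (inj_eq (imset_inj e_inj)). Qed.

(** Postcomposition with [s] is a bijection on embeddings that moves image edges along. *)
Lemma card_embedding_perm (s : {perm W}) (A : {set W}) :
  #|[set f : embedding G W | [set s x | x in A]%SET \in image_edges (val f)]%SET| =
  #|[set f : embedding G W | A \in image_edges (val f)]%SET|.
Proof.
have comp_inj (t : {perm W}) f : injectiveb [ffun x => t (val f x)].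
  by apply/injectiveP => x y; rewrite !ffunE => /perm_inj/embedding_inj.
pose h (t : {perm W}) f : embedding G W :=
  exist (fun g : {ffun G -> W} => injectiveb g) _ (comp_inj t f).
have hK t : cancel (h t) (h t^-1%g).
  by move=> f; apply: val_inj; apply/ffunP => x; rewrite /= !ffunE permK.
rewrite -[RHS](card_imset _ (can_inj (hK s))); apply: eq_card => f; rewrite !inE.
apply/idP/imsetP => [sf|[g]].
  exists (h s^-1%g f); last by rewrite -{1}(invgK s) hK.
  rewrite inE; apply/image_edgesP; have /image_edgesP[x [y [sA xy]]] := sf.
  exists x, y; split => //=; rewrite !ffunE.
  apply: (imset_inj (@perm_inj _ s)); rewrite sA.
  by rewrite finset.imsetU !finset.imset_set1 !permKV.
rewrite inE => /image_edgesP[x [y [-> xy]]] ->.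
apply/image_edgesP; exists x, y; split => //=.
by rewrite finset.imsetU !finset.imset_set1 !ffunE.
Qed.

Lemma perm_pair (A B : {set W}) : #|A| = 2%N -> #|B| = 2%N ->
  exists s : {perm W}, [set s x | x in A]%SET = B.
Proof.
move=> /eqP/cards2P[u [v [uv ->]]] /eqP/cards2P[u' [v' [uv' ->]]].
(* The first transposition sends [u] to [u']; the second sends the image of [v] to [v'] and fixes
   [u']. *)
exists (tperm u u' * tperm (tperm u u' v) v')%g.
rewrite finset.imsetU !finset.imset_set1 !permM tpermL tpermL.
congr ([set _; _]%SET); rewrite tpermD//; last by rewrite eq_sym.
by rewrite -[X in _ != X](tpermL u u') (inj_eq perm_inj) eq_sym.
Qed.

(** The symmetric group of [W] is transitive on pairs, so all degrees agree; their sum counts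
    incidences between edges and embeddings. The multiplied form avoids a division. *)
Lemma degree_edge_indices i :
  (#|I| * #|[set f | i \in edge_indices f]%SET| = #|edges G| * (#|W| ^_ #|G|))%N.
Proof.
have deg m : #|[set f | m \in edge_indices f]%SET| =
  #|[set f | i \in edge_indices f]%SET|.
  have [s sE] := perm_pair (card_edge_set i) (card_edge_set m).
  transitivity #|[set f : embedding G W | e m \in image_edges (val f)]%SET|.
    by apply: eq_card => f; rewrite !inE.
  rewrite -sE card_embedding_perm.
  by apply: eq_card => f; rewrite !inE.
transitivity (\sum_m #|[set f | m \in edge_indices f]%SET|)%N.
  by rewrite (eq_bigr _ (fun m _ => deg m)) sum_nat_const.
transitivity (\sum_f #|edge_indices f|)%N; last first.
  by rewrite (eq_bigr _ (fun f _ =>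
    card_edge_indices f)) sum_nat_const card_embedding mulnC.
under eq_bigr => m _ do rewrite -sum1_card big_mkcond/=.
under [RHS]eq_bigr => f _ do rewrite -sum1_card big_mkcond/=.
by rewrite exchange_big/=; apply: eq_bigr => f _; apply: eq_bigr => m _;
  rewrite inE.
Qed.

Lemma card_ffun_fixed (A : {set G}) (g : G -> W) :
  (#|[set f : {ffun G -> W} | [forall (x | x \in A), f x == g x]]%SET| <=
   #|W| ^ (#|G| - #|A|))%N.
Proof.
pose B := {x : G | x \notin A}.
have <- : #|{ffun B -> W}| = (#|W| ^ (#|G| - #|A|))%N.
  rewrite card_ffun card_sig; congr (_ ^ _)%N.
  by rewrite -(cardC (mem A)) addKn; apply: eq_card => x; rewrite !inE.
pose r (f : {ffun G -> W}) : {ffun B -> W} := [ffun x => f (val x)].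
apply: (leq_card_in r) => f1 f2; rewrite !inE => /forallP h1 /forallP h2 /ffunP rE.
apply/ffunP => x; have [xA|xA] := boolP (x \in A).
  move: (h1 x) (h2 x); rewrite xA /= => /eqP -> /eqP ->; exact: erefl.
by have := rE (exist _ x xA); rewrite !ffunE.
Qed.

(** Preimages of the three vertices can be chosen in [#|G|^3] ways; the other [#|G| - 3] values are
    then arbitrary in [W]. *)
Lemma card_embedding_through3 (u v w : W) : u != v -> u != w -> v != w ->
  (#|[set f : embedding G W | [&& u \in codom (val f), v \in codom (val f) &
     w \in codom (val f)]]%SET| <= #|G| ^ 3 * #|W| ^ (#|G| - 3))%N.
Proof.
move=> uv uw vw.
pose Q (t : G * G * G) f :=
  [&& val f t.1.1 == u, val f t.1.2 == v & val f t.2 == w].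
have Qt t : (#|[set f | Q t f]%SET| <= #|W| ^ (#|G| - 3))%N.
  case: t => [[x y] z];
    have [/and3P[xy xz yz]|nd] := boolP [&& x != y, x != z & y != z].
    have <- : #|[set x; y; z]%SET| = 3%N.
      by rewrite finset.setUC cardsU1 cards2 !inE negb_or ![z == _]eq_sym xy xz yz.
    apply: leq_trans (card_ffun_fixed [set x; y; z]%SET
      (fun t => if t == x then u else if t == y then v else w)).
    rewrite -(card_imset _ val_inj); apply: subset_leq_card.
    apply/fintype.subsetP => g /imsetP[f];
      rewrite !inE => /and3P[/eqP fx /eqP fy /eqP fz] ->.
    apply/forallP => t; apply/implyP; rewrite !inE => /orP[/orP[]|] /eqP ->.
    - by rewrite eqxx fx.
    - by rewrite [y == x]eq_sym (negbTE xy) eqxx fy.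
    - by rewrite [z == x]eq_sym [z == y]eq_sym (negbTE xz) (negbTE yz) fz.
  rewrite eq_card0// => f; rewrite inE;
    apply/negP => /and3P[/eqP fx /eqP fy /eqP fz].
  move: nd; rewrite -!(inj_eq (@embedding_inj _ _ f)).
  by move: fx fy fz => /= -> -> ->; rewrite uv uw vw.
apply: (@leq_trans (\sum_(t : G * G * G) #|[set f | Q t f]%SET|)).
  rewrite -sum1_card;
    under [leqRHS]eq_bigr => t _ do rewrite -sum1_card big_mkcond/=.
  rewrite exchange_big/= big_mkcond; apply: leq_sum => f _; rewrite inE.
  case: ifPn => // /and3P[/codomP[x ux] /codomP[y vy] /codomP[z wz]].
  rewrite (bigD1 (x, y, z))//= inE /Q /= -ux -vy -wz !eqxx.
  exact: leq_addr.
apply: (@leq_trans (\sum_(t : G * G * G) #|W| ^ (#|G| - 3))%N).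
  exact: leq_sum.
by rewrite sum_nat_const !card_prod !expnS expn0 muln1 [X in (_ <= X * _)%N]mulnA.
Qed.

(** Two distinct edges span at least three vertices, which saves a factor of order [#|W|] against
    the degree. *)
Lemma codegree_edge_indices i m : i != m ->
  (#|[set f | (i \in edge_indices f) && (m \in edge_indices f)]%SET| <=
   #|G| ^ 3 * #|W| ^ (#|G| - 3))%N.
Proof.
move=> im; have /eqP/cards2P[u [v [uv iE]]] := card_edge_set i.
have [w wm] : exists w, w \in e m :\: e i.
  apply/set0Pn; rewrite finset.setD_eq0; apply: contra im => mi;
    rewrite -(inj_eq e_inj).
  by rewrite eq_sym eqEcard mi !card_edge_set.
move: wm; rewrite inE iE !inE negb_or => /andP[/andP[wu wv] wm].
rewrite eq_sym in wu; rewrite eq_sym in wv.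
apply: leq_trans (card_embedding_through3 uv wu wv).
have sub f j x : j \in edge_indices f -> x \in e j -> x \in codom (val f).
  rewrite inE => /image_edgesP[y [z [-> _]]].
  by rewrite !inE => /orP[]/eqP ->; exact: codom_f.
apply: subset_leq_card; apply/fintype.subsetP => f; rewrite !inE => /andP[fi fm].
have fi' : i \in edge_indices f by rewrite inE.
have fm' : m \in edge_indices f by rewrite inE.
apply/and3P; split.
- by apply: sub fi' _; rewrite iE !inE eqxx.
- by apply: sub fi' _; rewrite iE !inE eqxx orbT.
- exact: sub fm' wm.
Qed.

End EmbeddingCounts.

(** * Reduction to the discrete cube *)

Section CopySum.
Context {R : realType} (G : simple_graph) (n k : nat).
Context (e : 'I_'C(n, 2) -> {set 'I_n}).
Hypothesis G_noiso : no_isolated_vertex G.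
Hypothesis G_edges : #|edges G| = k.
Hypothesis e_enum : edge_enumeration e.
Local Notation I := 'I_'C(n, 2).
Local Notation lt_ord := (fun i j : I => (i < j)%N).

Let e_inj : injective e. Proof. by case: e_enum. Qed.
Let e_pairs : [set e i | i : I]%SET = [set A : {set 'I_n} | #|A| == 2%N]%SET.
Proof. by case: e_enum. Qed.

Lemma lt_ord_trans : transitive lt_ord.
Proof. by move=> j i m; exact: ltn_trans. Qed.

Lemma sorted_enum_ord (K : {set I}) : sorted lt_ord (enum K).
Proof.
rewrite {1}/enum_mem; apply: sorted_filter; first exact: lt_ord_trans.
by have := iota_ltn_sorted 0 'C(n, 2); rewrite -val_enum_ord sorted_map enumT.
Qed.

(** Strictly increasing tuples are the canonical enumerations of [k]-sets, so a sum over
    [kappa_1 < ... < kappa_k] is one over sets. *)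
Lemma card_sorted_tuple (K : {set I}) : #|K| = k ->
  #|[set kappa : k.-tuple I | sorted lt_ord kappa &
      [set i in kappa] == K]%SET| = 1%N.
Proof.
move=> Kk; have sz : size (enum K) == k by rewrite -cardE Kk.
apply/eqP/cards1P; exists (Tuple sz); apply/setP => kappa; rewrite !inE.
apply/andP/eqP => [[sk /eqP kK]|->]; last first.
  split; first exact: sorted_enum_ord.
  by apply/eqP/setP => i; rewrite inE /= mem_enum.
apply: val_inj; apply: (irr_sorted_eq lt_ord_trans) => //.
- by move=> i; rewrite /= ltnn.
- exact: sorted_enum_ord.
- by move=> i; rewrite /= mem_enum -kK inE.
Qed.

Lemma card_embedding_copies (kappa : k.-tuple I) :
  #|[set f : embedding G 'I_n | edge_indices e f == [set i in kappa]%SET]%SET| =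
  (`[< forms_copy G e kappa >] * aut_order G)%N.
Proof.
rewrite /forms_copy (_ : [set e i | i in kappa]%SET =
  [set e i | i in [set i in kappa]]%SET).
  rewrite -card_embedding_onto//; last first.
    by move=> B /imsetP[i _ ->]; exact: card_edge_set.
  by apply: eq_card => f; rewrite !inE edge_indices_eq.
by apply/setP => B; apply/imsetP/imsetP => -[i ik ->]; exists i;
  rewrite // inE in ik *.
Qed.

(** Double counting of pairs of an increasing tuple and an embedding with the same edges: a tuple
    has [aut_order G] embeddings or none, an embedding exactly one tuple. With [Y] arbitrary, the
    identity holds at every sample point. *)
Lemma sum_copies (Y : I -> R) (c : R) :
  (aut_order G)%:R *
    \sum_(kappa : k.-tuple I | sorted lt_ord kappa)
      (`[< forms_copy G e kappa >])%:R * (\prod_(i < k) Y (tnth kappa i) - c) =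
  \sum_(f : embedding G 'I_n) (\prod_(i in edge_indices e f) Y i - c).
Proof.
pose g (K : {set I}) := \prod_(i in K) Y i - c.
have gE (kappa : k.-tuple I) : sorted lt_ord kappa ->
    \prod_(i < k) Y (tnth kappa i) - c = g [set i in kappa]%SET.
  move=> sk; rewrite /g -(big_tuple _ _ kappa predT) big_uniq/=.
    by congr (_ - _); apply: eq_bigl => i; rewrite inE.
  apply: (sorted_uniq lt_ord_trans) => // i; exact: ltnn.
transitivity (\sum_(kappa : k.-tuple I | sorted lt_ord kappa)
    \sum_(f : embedding G 'I_n | edge_indices e f == [set i in kappa]%SET)
      g (edge_indices e f)).
  rewrite mulr_sumr; apply: eq_bigr => kappa sk.
  rewrite [RHS](eq_bigr (fun=> g [set i in kappa]%SET)) => [|f ef];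
    last by rewrite (eqP ef).
  rewrite sumr_const gE// mulrA -natrM mulnC -card_embedding_copies mulr_natl.
  by congr (_ *+ _); apply: eq_card => f; rewrite inE.
rewrite (exchange_big_dep predT)//=; apply: eq_bigr => f _.
rewrite sumr_const (_ : #|_| = 1%N)//.
have fk : #|edge_indices e f| = k by rewrite card_edge_indices.
rewrite -[RHS](card_sorted_tuple fk).
by apply: eq_card => kappa; rewrite !inE [_ == edge_indices e f]eq_sym.
Qed.

End CopySum.

Section FiniteReduction.
Context {d : measure_display} {T : measurableType d} {R : realType}
  {P : probability T R} (I : finType) (p : R) (X : I -> {RV P >-> R}).
Hypothesis X_bernoulli : forall i, bernoulli_rv p (X i).
Hypothesis X_indep : mutually_independent X.
Local Notation cube := {ffun I -> bool}.

Let cell (w : cube) : set T :=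
  \bigcap_(i in [set` [set: I]%SET]) (X i @^-1` [set ((w i)%:R : R)]).

Let cellE w t : cell w t <-> forall i, X i t = (w i)%:R.
Proof. by split=> [h i|h i _]; [apply: h => /=; rewrite inE|exact: h]. Qed.

Let measurable_cell w : measurable (cell w).
Proof.
apply: fin_bigcap_measurable; first exact: finite_finset.
by move=> i _; rewrite -[_ @^-1` _]setTI; exact: measurable_funP.
Qed.

Let P_cell w : P (cell w) = (weight p w)%:E.
Proof.
rewrite /cell (X_indep _ (B := fun i => [set ((w i)%:R : R)])) => [|i];
  last exact: measurable_set1.
rewrite /weight -prodEFin; apply: eq_big => [i|i _]; first by rewrite inE.
have [h1 h0] := X_bernoulli i.
by case: (w i).
Qed.

Let P_ge (A : set T) (Q : pred cube) : measurable A ->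
  (forall (w : cube) t, (forall i, X i t = (w i)%:R) -> Q w -> A t) ->
  ((\sum_w weight p w * (Q w)%:R)%:E <= P A)%E.
Proof.
move=> mA h.
have -> : \sum_w weight p w * (Q w)%:R = \sum_(w | Q w) weight p w.
  rewrite [RHS]big_mkcond; apply: eq_bigr => w _.
  by case: (Q w); rewrite ?mulr1 ?mulr0.
have <- : P (\bigcup_(w in [set` enum Q]) cell w) = (\sum_(w | Q w) weight p w)%:E.
  rewrite measure_fin_bigcup//.
  - rewrite -fsbig_seq ?enum_uniq// big_enum_cond/= -sumEFin.
    by apply: eq_big => [w|w _]; [rewrite andbT|exact: P_cell].
  - move=> w w' _ _ [t [/cellE tw /cellE tw']]; apply/ffunP => i.
    have := tw i; rewrite tw' => /eqP; rewrite eqr_nat.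
    by case: (w i); case: (w' i).
apply: le_measure; rewrite ?inE//.
  by apply: fin_bigcup_measurable.
by move=> t [w /=]; rewrite mem_enum => Qw /cellE tw; exact: h tw Qw.
Qed.

(* Applying the lower bound to an event and to its complement avoids any
   discussion of the null set where some [X i] is not 0 or 1. *)
Lemma probability_cube (A : set T) (Q : pred cube) : measurable A ->
  (forall (w : cube) t, (forall i, X i t = (w i)%:R) -> Q w <-> A t) ->
  P A = (\sum_w weight p w * (Q w)%:R)%:E.
Proof.
move=> mA h; apply/eqP; rewrite eq_le; apply/andP; split; last first.
  by apply: P_ge => // w t /h[].
have : ((\sum_w weight p w * (predC Q w)%:R)%:E <= P (~` A))%E.
  apply: P_ge; first exact: measurableC.
  by move=> w t tw /= /negP nQ At; apply: nQ; apply/(h w t tw).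
rewrite probability_setC// -(@fineK _ (P A)) ?fin_num_measure//.
rewrite -EFinB !lee_fin => hC.
have := sum_weight I p.
rewrite (_ : \sum_w weight p w =
  \sum_w weight p w * (Q w)%:R + \sum_w weight p w * (predC Q w)%:R).
  by lra.
by rewrite -big_split/=; apply: eq_bigr => w _; case: (Q w) => /=; ring.
Qed.

End FiniteReduction.

(** * Asymptotics of the normalisation *)

Lemma ffact_ge (m j : nat) : ((m.+1 - j) ^ j <= m ^_ j)%N.
Proof.
elim: j m => [//|j IH] [|m]; first by rewrite subSS sub0n exp0n.
rewrite ffactnS /= expnS leq_mul//;
  first by rewrite subSS (leq_trans (leq_subr _ _)).
by rewrite subSS; exact: IH.
Qed.

Lemma ffact_le (m j : nat) : (m ^_ j <= m ^ j)%N.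
Proof.
elim: j m => [//|j IH] m;
  rewrite ffactnS expnS leq_mul2l (leq_trans (IH _)) ?orbT//.
by case: j {IH} => // j; rewrite leq_exp2r// leq_pred.
Qed.

Lemma bin2_double (n : nat) : ('C(n, 2) * 2 = n * n.-1)%N.
Proof. by have := bin_ffact n 2; rewrite ffactnS ffactn1. Qed.

(** [n ^_ l] splits as [n (n - 1)] times [(n - 2) ^_ (l - 2)], and [n (n - 1) = 2 'C(n, 2)]; the
    binomial then cancels. *)
Lemma degree_solve (n k l deg : nat) : (2 <= n)%N -> (2 <= l)%N ->
  ('C(n, 2) * deg = k * n ^_ l)%N -> deg = (2 * k * (n - 2) ^_ (l - 2))%N.
Proof.
move=> n2 l2 h; have C0 : (0 < 'C(n, 2))%N by rewrite bin_gt0.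
have /eqP := h; move: (bin2_double n).
have -> : n ^_ l = (n * n.-1 * (n - 2) ^_ (l - 2))%N.
  clear h C0; case: l l2 => [|[|l]]// _; case: n n2 => [|[|n]]// _.
  by rewrite !ffactnS /= mulnA !subSS !subn0.
move=> <- /eqP h'; apply/eqP; rewrite -(eqn_pmul2l C0) h'; apply/eqP; lia.
Qed.

Lemma degree_gt0 (n k l : nat) : (0 < k)%N -> (2 * l <= n)%N ->
  (0 < 2 * k * (n - 2) ^_ (l - 2))%N.
Proof. by move=> k0 ln; rewrite !muln_gt0 ffact_gt0; lia. Qed.

(** For [2 l <= n] every factor of [(n - 2) ^_ (l - 2)] is at least [n / 2], which is the source of
    [2 ^+ (l - 2)]. *)
Lemma binomial_bounds (R : realType) (n l : nat) : (3 <= l)%N -> (2 * l <= n)%N ->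
  [/\ 'C(n - 2, l - 2)%:R <= n%:R ^+ (l - 2) :> R,
      n%:R ^+ (l - 2) <= 2 ^+ (l - 2) * (l - 2)`!%:R * 'C(n - 2, l - 2)%:R :> R,
      'C(n, 2)%:R <= n%:R ^+ 2 :> R &
      n%:R ^+ 2 <= 4 * 'C(n, 2)%:R :> R].
Proof.
move=> l_ge3 ln; rewrite -!natrX -!natrM !ler_nat; split.
- rewrite (@leq_trans ((n - 2) ^_ (l - 2)))//.
    by rewrite -bin_ffact leq_pmulr// fact_gt0.
  by rewrite (leq_trans (ffact_le _ _))// leq_exp2r ?leq_subr//; lia.
- rewrite -mulnA [(_`! * _)%N]mulnC bin_ffact.
  apply: leq_trans (leq_mul (leqnn _) (ffact_ge _ _)).
  by rewrite -expnMn leq_exp2r; lia.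
- have := bin2_double n; nia.
- have := bin2_double n; nia.
Qed.

Lemma binomial_positive (R : realType) (n l : nat) : (3 <= l)%N -> (2 * l <= n)%N ->
  [/\ 0 < n%:R :> R, 0 < 'C(n - 2, l - 2)%:R :> R & 0 < 'C(n, 2)%:R :> R].
Proof. by move=> l_ge3 ln; split; rewrite ltr0n ?bin_gt0; lia. Qed.

(** * The speed and the consequences of the growth hypotheses *)

Section Scaling.
Context {R : realType} (k l a : nat) (p beta : nat -> R).
Hypothesis k_ge2 : (2 <= k)%N.
Hypothesis l_ge3 : (3 <= l)%N.
Hypothesis a_gt0 : (0 < a)%N.
Hypothesis p01 : forall n, 0 < p n < 1.
Hypothesis beta_gt0 : forall n, 0 < beta n.

Let c0 : R := 2 * k%:R / a%:R * (l - 2)`!%:R.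
(** The standard deviation of [p^(k-1) (X_i - p)], so that [q^2 = q2]. *)
Let q n := p n ^+ (k - 1) * Num.sqrt (p n * (1 - p n)).
Let q2 n := p n ^+ (2 * k).-1 * (1 - p n).

Definition speed n : R := c0 ^+ 2 * beta n ^+ 2 / cnp k l a n (p n) ^+ 2.

Hypothesis beta_lower : negligible_wrt (fun n => n%:R ^+ (l - 1) * q n) beta.
Hypothesis beta_upper : negligible_wrt beta (fun n => n%:R ^+ l * q n ^+ 4).

Lemma c0_gt0 : 0 < c0.
Proof.
rewrite mulr_gt0 ?divr_gt0 ?mulr_gt0 ?ltr0n ?fact_gt0//.
exact: leq_trans k_ge2.
Qed.

Let q_gt0 n : 0 < q n.
Proof.
case/andP: (p01 n) => p0 p1.
by rewrite mulr_gt0 ?exprn_gt0// sqrtr_gt0 mulr_gt0// subr_gt0.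
Qed.

Let q_sqr n : q n ^+ 2 = q2 n.
Proof.
case/andP: (p01 n) => p0 p1.
rewrite exprMn sqr_sqrtr ?mulr_ge0 ?subr_ge0 ?ltW// -exprM mulrA -exprSr.
by congr (_ ^+ _ * _); lia.
Qed.

Let q_le1 n : q n <= 1.
Proof.
rewrite -(@expr_le1 _ 2) ?(ltW (q_gt0 n))// q_sqr /q2; case/andP: (p01 n) => p0 p1.
rewrite mulr_ile1 ?exprn_ge0 ?exprn_ile1 ?subr_ge0 ?(ltW p0) ?(ltW p1)//.
by rewrite gerBl ltW.
Qed.

Lemma speedE n : speed n =
  1 / ('C(n - 2, l - 2)%:R ^+ 2 * 'C(n, 2)%:R) *
  (1 / (p n ^+ (2 * k - 1) * (1 - p n))) * beta n ^+ 2.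
Proof.
case/andP: (p01 n) => p0 p1; rewrite /speed.
have -> : cnp k l a n (p n) ^+ 2 =
    c0 ^+ 2 * ('C(n - 2, l - 2)%:R ^+ 2 * 'C(n, 2)%:R) * q2 n.
  rewrite /cnp !exprMn sqr_sqrtr; last first.
    by rewrite !mulr_ge0 ?subr_ge0 ?(ltW p0) ?(ltW p1).
  rewrite -q_sqr /q exprMn sqr_sqrtr; last by rewrite mulr_ge0 ?subr_ge0 ?ltW.
  by rewrite /c0; ring.
rewrite /q2 -subn1; have := c0_gt0;
  move: c0 (_ ^+ 2 * _%:R) (_ * (1 - p n)) => c M Q cp.
have c2 : c ^+ 2 * c ^- 2 = 1 by rewrite mulfV// gt_eqF// exprn_gt0.
rewrite 2!invfM !div1r.
transitivity (c ^+ 2 * c ^- 2 * (M^-1 * Q^-1 * beta n ^+ 2)); first by ring.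
by rewrite c2 mul1r.
Qed.

Let r1 n := n%:R ^+ (l - 1) * q n / beta n.
Let r2 n := beta n / (n%:R ^+ l * q n ^+ 4).

(** Multiplying the two growth ratios eliminates [beta]; as both tend to 0, [n q^3] tends to
    infinity. *)
Let r12 n : (0 < n)%N -> r1 n * r2 n = (n%:R * q n ^+ 3)^-1.
Proof.
move=> n0; have nR : n%:R != 0 :> R by rewrite pnatr_eq0 -lt0n.
have lE : n%:R ^+ l = n%:R * n%:R ^+ (l - 1) :> R.
  by rewrite -exprS -addn1 subnK// (leq_trans _ l_ge3).
have nl : n%:R ^+ (l - 1) != 0 :> R by rewrite expf_neq0.
have qn : q n != 0 by rewrite gt_eqF.
have bn : beta n != 0 by rewrite gt_eqF.
rewrite /r1 /r2 lE; move: (_ ^+ (l - 1)) (q n) (beta n) nl qn bn => u v w u0 v0 w0.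
by field; rewrite nR u0 v0 w0.
Qed.

(** Since ['C(n - 2, l - 2)^2 'C(n, 2) <= n^(2 (l - 1))], the speed is at least [(r1 n)^-2]. *)
Lemma speed_oo : speed n @[n --> \oo] --> +oo.
Proof.
apply/cvgryPge => M.
have M1 : 0 < (`|M| + 1)^-1 by rewrite invr_gt0 ltr_pwDr.
near=> n.
have ln : (2 * l <= n)%N by near: n; exact: nbhs_infty_ge.
have q0 := q_gt0 n; have [n0 C0 N0] := binomial_positive R l_ge3 ln;
  have [hC _ hN _] := binomial_bounds R l_ge3 ln.
have r1n : 0 < r1 n by rewrite divr_gt0// mulr_gt0 ?exprn_gt0.
have rM : r1 n <= (`|M| + 1)^-1 by near: n; exact: (cvgr_le _ beta_lower).
have rr : r1 n ^+ 2 <= (`|M| + 1)^-1.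
  apply: le_trans rM; rewrite expr2 ler_piMl ?(ltW r1n)//.
  apply: (@le_trans _ _ (`|M| + 1)^-1); first by near: n;
    exact: (cvgr_le _ beta_lower).
  by rewrite invf_le1 ?ltr_pwDr// lerDr.
have MM : M <= (r1 n ^+ 2)^-1.
  apply: (@le_trans _ _ (`|M| + 1)).
    by rewrite (le_trans (ler_norm _))// lerDl.
  by rewrite -[leLHS]invrK lef_pV2 ?posrE ?exprn_gt0.
apply: (le_trans MM).
have -> : speed n =
  beta n ^+ 2 / ('C(n - 2, l - 2)%:R ^+ 2 * 'C(n, 2)%:R * q n ^+ 2).
  by rewrite speedE q_sqr /q2 subn1 !div1r !invfM; ring.
have -> : (r1 n ^+ 2)^-1 =
  beta n ^+ 2 / (n%:R ^+ (l - 2) ^+ 2 * n%:R ^+ 2 * q n ^+ 2).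
  have -> : n%:R ^+ (l - 2) ^+ 2 * n%:R ^+ 2 = (n%:R ^+ (l - 1)) ^+ 2 :> R.
    by rewrite -exprMn -exprSr; congr (_ ^+ _ ^+ _); lia.
  by rewrite /r1 -exprMn -expr_div_n -exprVn invf_div.
have q20 : 0 < q n ^+ 2 by rewrite exprn_gt0.
have P1 : 0 < 'C(n - 2, l - 2)%:R ^+ 2 * 'C(n, 2)%:R * q n ^+ 2.
  by apply: mulr_gt0 q20; rewrite mulr_gt0 ?exprn_gt0.
have P2 : 0 < n%:R ^+ (l - 2) ^+ 2 * n%:R ^+ 2 * q n ^+ 2.
  by apply: mulr_gt0 q20; rewrite mulr_gt0 ?exprn_gt0.
rewrite ler_pM2l ?exprn_gt0// lef_pV2 ?posrE//.
rewrite ler_pM2r ?exprn_gt0//; apply: ler_pM => //.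
by rewrite lerXn2r ?nnegrE ?exprn_ge0//.
Unshelve. all: by end_near. Qed.

Let D n := (2 * k * (n - 2) ^_ (l - 2))%N.
Let D2 n := (l ^ 3 * n ^ (l - 3))%N.

(** The variance condition [tau_eq] for [tau = speed / (a beta)], the coefficient of the embedding
    count in [s_n S_n]. It identifies [v] as [c0^2], hence the rate function. *)
Lemma speed_scaling n : (2 * l <= n)%N ->
  (speed n / (beta n * a%:R) * (D n)%:R) ^+ 2 * ('C(n, 2)%:R * q2 n) =
  c0 ^+ 2 * speed n.
Proof.
move=> ln; have [n0 C0 N0] := binomial_positive R l_ge3 ln.
have q20 : 0 < q2 n by rewrite -q_sqr exprn_gt0.
have b0 := beta_gt0 n.
have aR : a%:R != 0 :> R by rewrite pnatr_eq0 -lt0n.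
have DE : (D n)%:R = a%:R * c0 * 'C(n - 2, l - 2)%:R :> R.
  by rewrite /D !natrM -bin_ffact natrM /c0; field.
have sE : speed n = beta n ^+ 2 / ('C(n - 2, l - 2)%:R ^+ 2 * 'C(n, 2)%:R * q2 n).
  by rewrite speedE /q2 subn1 !div1r !invfM; ring.
rewrite DE sE;
  move: c0 (q2 n) (beta n) 'C(n, 2)%:R 'C(n - 2, l - 2)%:R C0 N0 q20 b0.
by move=> c u b N C C0 N0 u0 b0; field; rewrite aR !gt_eqF.
Qed.

(** [D2 / D] is at most of order [1 / n], so the ratio is at most a constant times
    [1 / (n q^2) <= 1 / (n q^3) = r1 r2]. *)
Lemma codegree_ratio_small : (D2 n)%:R / ((D n)%:R * q2 n) @[n --> \oo] --> 0.
Proof.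
pose c : R := l%:R ^+ 3 * 2 ^+ (l - 2).
have c_ge0 : 0 <= c by rewrite mulr_ge0.
have h : c * (r1 n * r2 n) @[n --> \oo] --> 0.
  rewrite -(mulr0 c); apply: cvgM; first exact: cvg_cst.
  by rewrite -(mulr0 0); apply: cvgM.
apply: (squeeze_cvgr _ (cvg_cst 0) h); near=> n.
have ln : (2 * l <= n)%N by near: n; exact: nbhs_infty_ge.
have q0 := q_gt0 n; have [n0 C0 N0] := binomial_positive R l_ge3 ln;
  have [_ hC _ _] := binomial_bounds R l_ge3 ln.
have q20 : 0 < q2 n by rewrite -q_sqr exprn_gt0.
have FE : (l - 2)`!%:R * 'C(n - 2, l - 2)%:R = ((n - 2) ^_ (l - 2))%:R :> R.
  by rewrite -natrM mulnC bin_ffact.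
rewrite -mulrA FE in hC.
have F0 : 0 < ((n - 2) ^_ (l - 2))%:R :> R.
  by rewrite -FE mulr_gt0// ltr0n fact_gt0.
have D0 : 0 < (D n)%:R :> R by rewrite ltr0n; exact: degree_gt0 (ltnW k_ge2) ln.
apply/andP; split; first by rewrite divr_ge0 ?(ltW (mulr_gt0 D0 q20)).
rewrite r12 -?(ltr0n R)//.
have -> : (n%:R * q n ^+ 3)^-1 = (n%:R * q n)^-1 / q2 n.
  by rewrite -q_sqr -invfM -mulrA -exprS.
rewrite invfM !mulrA ler_pM2r ?invr_gt0//.
apply: (@le_trans _ _ (c / n%:R)); last first.
  rewrite -mulrA ler_wpM2l// lef_pV2 ?posrE//; last exact: mulr_gt0.
  by rewrite ler_piMr ?q_le1.
rewrite ler_pdivrMr// mulrAC ler_pdivlMr//.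
have DF : ((n - 2) ^_ (l - 2))%:R <= (D n)%:R :> R.
  by rewrite ler_nat /D leq_pmull//; lia.
have -> : (D2 n)%:R * n%:R = l%:R ^+ 3 * n%:R ^+ (l - 2) :> R.
  rewrite /D2 natrM !natrX -mulrA -exprSr; congr (_ * _ ^+ _); lia.
apply: (@le_trans _ _ (l%:R ^+ 3 * (2 ^+ (l - 2) * ((n - 2) ^_ (l - 2))%:R))).
  by rewrite ler_wpM2l.
by rewrite mulrA ler_wpM2l.
Unshelve. all: by end_near. Qed.

(** Up to constants the ratio is [beta^2 / (n^(2 l) q^6)]; by [q <= 1] it is at most
    [r2^2 = beta^2 / (n^(2 l) q^8)], again up to constants. *)
Lemma speed_ratio_small : speed n / ('C(n, 2)%:R * q2 n ^+ 2) @[n --> \oo] --> 0.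
Proof.
pose c : R := (4 * (2 ^+ (l - 2) * (l - 2)`!%:R)) ^+ 2.
have c_ge0 : 0 <= c by exact: sqr_ge0.
have h : c * (r2 n * r2 n) @[n --> \oo] --> 0.
  rewrite -(mulr0 c); apply: cvgM; first exact: cvg_cst.
  by rewrite -(mulr0 0); apply: cvgM.
apply: (squeeze_cvgr _ (cvg_cst 0) h); near=> n.
have ln : (2 * l <= n)%N by near: n; exact: nbhs_infty_ge.
have q0 := q_gt0 n; have [n0 C0 N0] := binomial_positive R l_ge3 ln;
  have [_ hC _ hN] := binomial_bounds R l_ge3 ln.
have q20 : 0 < q2 n by rewrite -q_sqr exprn_gt0.
have -> : speed n = beta n ^+ 2 / ('C(n - 2, l - 2)%:R ^+ 2 * 'C(n, 2)%:R * q2 n).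
  by rewrite speedE /q2 subn1 !div1r !invfM; ring.
move: c_ge0; rewrite /c; set f := 2 ^+ (l - 2) * _ => c_ge0.
set C : R := 'C(n - 2, l - 2)%:R in C0 hC *; set N : R := 'C(n, 2)%:R in N0 hN *.
have P1 : 0 < C ^+ 2 * N * q2 n.
  by apply: mulr_gt0 q20; rewrite mulr_gt0 ?exprn_gt0.
have P2 : 0 < N * q2 n ^+ 2 by rewrite mulr_gt0// exprn_gt0.
apply/andP; split;
  first by rewrite divr_ge0 ?(ltW P2)// divr_ge0 ?(ltW P1) ?sqr_ge0.
have -> : beta n ^+ 2 / (C ^+ 2 * N * q2 n) / (N * q2 n ^+ 2) =
    beta n ^+ 2 * ((C * N) ^+ 2 * q2 n ^+ 3)^-1.
  by rewrite -mulrA -invfM; congr (_ * _^-1); ring.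
have f0 : 0 < f by rewrite mulr_gt0 ?exprn_gt0// ltr0n fact_gt0.
have nCN : n%:R ^+ l <= 4 * f * (C * N).
  have -> : n%:R ^+ l = n%:R ^+ (l - 2) * n%:R ^+ 2 :> R.
    by rewrite -exprD subnK// ltnW.
  have -> : 4 * f * (C * N) = (f * C) * (4 * N) by ring.
  by apply: ler_pM => //; rewrite exprn_ge0.
have CN0 : 0 < C * N by rewrite mulr_gt0.
have q30 : 0 < q2 n ^+ 3 by rewrite exprn_gt0.
have q4 : 0 < (q n ^+ 4) ^+ 2 by rewrite !exprn_gt0.
have nl : 0 < (n%:R ^+ l) ^+ 2 :> R by rewrite !exprn_gt0.
have -> : (4 * f) ^+ 2 * (r2 n * r2 n) =
    beta n ^+ 2 * ((4 * f) ^+ 2 / ((n%:R ^+ l) ^+ 2 * (q n ^+ 4) ^+ 2)).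
  by rewrite /r2 !invfM expr2; ring.
rewrite ler_wpM2l ?sqr_ge0// ler_pdivlMr; last exact: mulr_gt0.
rewrite mulrC ler_pdivrMr; last by apply: mulr_gt0 q30; exact: exprn_gt0.
rewrite [leRHS]mulrA -[in leRHS]exprMn; apply: ler_pM; rewrite ?sqr_ge0//.
  rewrite lerXn2r// nnegrE ?exprn_ge0//.
  by apply/ltW/mulr_gt0 => //; exact: mulr_gt0.
by rewrite -q_sqr -!exprM; apply: ler_wiXn2l; rewrite ?q_le1// ltW.
Unshelve. all: by end_near. Qed.

End Scaling.

(** * Assembly of the moderate deviation principle *)

Theorem theorem1p1 (R : realType) (G : simple_graph) (k l a : nat)
  (G_noiso : no_isolated_vertex G)
  (G_edges : #|edges G| = k) (G_vertices : #|G| = l) (G_aut : aut_order G = a)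
  (k_ge2 : (2 <= k)%N) (l_ge3 : (3 <= l)%N)
  (d : nat -> measure_display) (T : forall n, measurableType (d n))
  (P : forall n, probability (T n) R)
  (p : nat -> R) (p01 : forall n, 0 < p n < 1)
  (e : forall n, 'I_'C(n, 2) -> {set 'I_n})
  (e_enum : forall n, edge_enumeration (e n))
  (X : forall n, 'I_'C(n, 2) -> {RV (P n) >-> R})
  (X_bernoulli : forall n i, bernoulli_rv (p n) (X n i))
  (X_indep : forall n, mutually_independent (X n))
  (beta : nat -> R) (beta_gt0 : forall n, 0 < beta n)
  (beta_incr : {homo beta : m n / (m <= n)%N >-> m <= n})
  (beta_lower : negligible_wrt
     (fun n => n%:R ^+ (l - 1) * p n ^+ (k - 1) * Num.sqrt (p n * (1 - p n)))
     beta)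
  (beta_upper : negligible_wrt beta
     (fun n => n%:R ^+ l *
        (p n ^+ (k - 1) * Num.sqrt (p n * (1 - p n))) ^+ 4)) :
  let S := fun n => subgraph_count_rv G k (e n) (X n) (p n) (beta n) in
  let s := fun n =>
    (2 * k%:R / a%:R * (l - 2)`!%:R) ^+ 2 * beta n ^+ 2 / cnp k l a n (p n) ^+ 2 in
  let I := fun x : R => (x ^+ 2 / (2 * (2 * k%:R / a%:R * (l - 2)`!%:R) ^+ 2))%:E in
  (forall n, s n =
     1 / ('C(n - 2, l - 2)%:R ^+ 2 * 'C(n, 2)%:R) *
     (1 / (p n ^+ (2 * k - 1) * (1 - p n))) * beta n ^+ 2) /\
  LDP (fun n => distribution (P n) (S n)) s I.
Proof.
move=> S s I.
have a_gt0 : (0 < a)%N.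
  rewrite -G_aut card_gt0; apply/set0Pn; exists (perm (@inj_id G)).
  by rewrite finset.in_set; apply/forallP => x; apply/forallP => y; rewrite !permE.
have k_gt0 : (0 < k)%N := ltnW k_ge2.
have sE n : s n = 1 / ('C(n - 2, l - 2)%:R ^+ 2 * 'C(n, 2)%:R) *
    (1 / (p n ^+ (2 * k - 1) * (1 - p n))) * beta n ^+ 2.
  exact: speedE.
split; first exact: sE.
have beta_lower' : negligible_wrt
    (fun n => n%:R ^+ (l - 1) * (p n ^+ (k - 1) * Num.sqrt (p n * (1 - p n)))) beta.
  by under eq_fun do rewrite mulrA.
have s_oo : s n @[n --> \oo] --> +oo by exact: speed_oo beta_lower'.
have c0 : 0 < 2 * k%:R / a%:R * (l - 2)`!%:R :> R by exact: c0_gt0.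
set c := 2 * k%:R / a%:R * (l - 2)`!%:R in c0.
have v0 : 0 < c ^+ 2 by rewrite exprn_gt0.
have p01' n : 0 <= p n <= 1 by case/andP: (p01 n) => *; rewrite !ltW.
have e_inj n : injective (e n) by case: (e_enum n).
have e_pairs n : [set e n i | i : 'I_'C(n, 2)]%SET =
    [set A : {set 'I_n} | #|A| == 2%N]%SET by case: (e_enum n).
pose K n := @edge_indices G 'I_n 'I_'C(n, 2) (e n).
pose Z n (w : {ffun 'I_'C(n, 2) -> bool}) : R :=
  (beta n)^-1 * (a%:R^-1 * family_count (K n) k (p n) w).
have aR : a%:R != 0 :> R by rewrite pnatr_eq0 -lt0n.
apply: (@gaussian_LDP R (fun n => {ffun 'I_'C(n, 2) -> bool})
  (fun n => @weight R 'I_'C(n, 2) (p n)) (fun n => weight_ge0 (p01' n))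
  (fun n => sum_weight _ (p n)) s Z (c ^+ 2) s_oo v0) => [t|n A mA]; last first.
  apply: (@probability_cube _ _ _ (P n) _ (p n) (X n) (X_bernoulli n) (X_indep n)
    (S n @^-1` A) (fun w => `[< A (Z n w) >])).
    by rewrite -[_ @^-1` _]setTI; exact: measurable_funP.
  (* At a sample point where the [X n i] take the values [w i], the statistic equals [Z n w], by the
     identity between copies and embeddings. *)
  move=> w t Xw; rewrite /Z (_ : _ * _ = S n t); last first.
    rewrite /S /= /subgraph_count_stat; congr (_ * _).
    apply: (mulfI aR); rewrite mulrA mulfV// mul1r -G_aut.
    rewrite (sum_copies G_noiso G_edges (e_enum n) (fun i => X n i t) (p n ^+ k)).
    apply: eq_bigr => f _; congr (_ - _).
    by apply: eq_bigr => i _; rewrite Xw.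
  by split => [/asboolP|h]; [|apply/asboolP].
pose D n := (2 * k * (n - 2) ^_ (l - 2))%N.
pose D2 n := (l ^ 3 * n ^ (l - 3))%N.
pose tau n := s n / (beta n * a%:R).
have -> : (fun n => (s n)^-1 * cgf (@weight R 'I_'C(n, 2) (p n))
      (fun w => t * (s n * Z n w))) =
    (fun n => (s n)^-1 * cgf (@weight R 'I_'C(n, 2) (p n))
      (fun w => t * (tau n * family_count (K n) k (p n) w))).
  apply/funext => n; congr (_ * _); apply: cgf_ext => w.
  by rewrite /Z /tau invfM !mulrA.
have deg n (i : 'I_'C(n, 2)) : #|[set f | i \in K n f]%SET| = D n.
  (* An index below ['C(n, 2)] exists only for [n >= 2], so that the degree formula holds for every
     [n]. *)
  have n2 : (2 <= n)%N by rewrite -bin_gt0; exact: leq_ltn_trans (ltn_ord i).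
  apply: degree_solve n2 (ltnW l_ge3) _.
  by have := degree_edge_indices G (@e_inj n) (e_pairs n) i; rewrite !card_ord G_edges G_vertices.
have codeg n (i m : 'I_'C(n, 2)) : i != m ->
    (#|[set f | (i \in K n f) && (m \in K n f)]%SET| <= D2 n)%N.
  move=> im; have := codegree_edge_indices G (@e_inj n) (e_pairs n) im.
  by rewrite card_ord G_vertices.
have cardK n f : #|K n f| = k by rewrite card_edge_indices.
apply: (cgf_family_count p01 k_gt0 cardK deg codeg s_oo v0).
- by near=> n; apply: (degree_gt0 k_gt0); near: n; exact: nbhs_infty_ge.
- near=> n; rewrite card_ord bin_gt0; apply: (@leq_trans (2 * l)); first by lia.
  by near: n; exact: nbhs_infty_ge.
- near=> n.
  have ln : (2 * l <= n)%N by near: n; exact: nbhs_infty_ge.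
  by rewrite card_ord; exact: (speed_scaling k_ge2 l_ge3 a_gt0 p01 beta_gt0 ln).
- exact: (codegree_ratio_small k_ge2 l_ge3 a_gt0 p01 beta_gt0 beta_lower' beta_upper).
- under eq_fun do rewrite card_ord.
  exact: speed_ratio_small.
Unshelve. all: by end_near. Qed.
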